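(* Let $F:P_0\mathbb{R}^n\to(0,\infty)$ be a positive $\mathbb P_0$-integrable function. Then the functional $$\Phi_F:\mathcal H\to(-\infty,+\infty],\qquad \Phi_F(h)=\ln\left(\int_{P_0\mathbb{R}^n}F(\gamma+h)\,d\mathbb P_0(\gamma)\right)+\frac14\|h\|_{\mathcal H}^2$$ is convex, i.e. $\Phi_F(\lambda_1h_1+\lambda_2h_2)\le\lambda_1\Phi_F(h_1)+\lambda_2\Phi_F(h_2)$ for all $h_1,h_2\in\mathcal H$ and $\lambda_1,\lambda_2\in(0,1)$ with $\lambda_1+\lambda_2=1$.
   Context: $P_0\mathbb{R}^n=\{\gamma\in C^0([0,\infty),\mathbb{R}^n):\gamma(0)=0\}$ with the Borel $\sigma$-algebra of the compact-open topology. $\mathbb P_0$ is the Wiener measure on $P_0\mathbb R^n$ normalized so that the coordinate process is a Brownian motion with generator $\Delta_{\mathbb R^n}$ (not $\frac12\Delta$), i.e. covariation $[W^a,W^b]_t=2t\delta_{ab}$; equivalently, for $0<t_1<\dots<t_k$, the law of $(\gamma_{t_1},\dots,\gamma_{t_k})$ is $\rho_{t_1}(0,dy_1)\rho_{t_2-t_1}(y_1,dy_2)\cdots\rho_{t_k-t_{k-1}}(y_{k-1},dy_k)$, where $\rho_t(x,dy)=(4\pi t)^{-n/2}e^{-|x-y|^2/4t}dy$. The Cameron–Martin space is $\mathcal H=\{h\in P_0\mathbb R^n:\ h \text{ absolutely continuous},\ \|h\|_{\mathcal H}^2=\int_0^\infty|\dot h_t|^2dt<\infty\}$. *)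

(* Defs.v *)
From HB Require Import structures.
From mathcomp Require Import all_boot all_order all_algebra.
From mathcomp Require Import all_classical all_reals all_analysis.
Set Implicit Arguments. Unset Strict Implicit. Unset Printing Implicit Defensive.
Import Order.TTheory GRing.Theory Num.Theory.
Import numFieldNormedType.Exports.
Local Open Scope classical_set_scope.
Local Open Scope ring_scope.

Section Paths.
Variables (R : realType) (n : nat).

(** Continuous paths [0,oo) -> R^n started at 0.  Points of R^n are
    functions 'I_n -> R; a cpath is stored as a function on all of R,
    normalised to be 0 on (-oo,0) so that it is determined by its values
    on [0,oo). *)
Definition is_path (g : R -> 'I_n -> R) : Prop :=
  [/\ g 0 = (fun _ => 0),
      (forall t, t < 0 -> g t = (fun _ => 0)) &
      (forall a, {within `[0, +oo[, continuous (fun t => g t a)})].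

Record cpath := CPath { pval :> R -> 'I_n -> R ; pvalP : is_path pval }.

Lemma is_path0 : is_path (fun _ _ => 0).
Proof. split => // a; apply: continuous_subspaceT => x; exact: cvg_cst. Qed.

Definition path0 := CPath is_path0.

HB.instance Definition _ := gen_eqMixin cpath.
HB.instance Definition _ := gen_choiceMixin cpath.
HB.instance Definition _ := isPointed.Build cpath path0.

Lemma is_path_lin (l1 l2 : R) (g1 g2 : cpath) :
  is_path (fun t a => l1 * g1 t a + l2 * g2 t a).
Proof.
case: g1 g2 => [g1 [g10 g1n g1c]] [g2 [g20 g2n g2c]] /=; split.
- by apply/funext => a; rewrite g10 g20 !mulr0 addr0.
- by move=> t /[dup] /g1n -> /g2n ->; apply/funext => a; rewrite !mulr0 addr0.
- move=> a x; apply: cvgD; apply: cvgM; [exact: cvg_cst|exact: g1c|exact: cvg_cst|exact: g2c].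
Qed.

Definition path_lin (l1 l2 : R) (g1 g2 : cpath) : cpath :=
  CPath (is_path_lin l1 l2 g1 g2).

Definition path_add (g h : cpath) : cpath := path_lin 1 1 g h.

(** The measurable structure: the sigma-algebra generated by the
    evaluation maps gamma |-> gamma_t^a (cylinder sigma-algebra), which
    coincides with the Borel sigma-algebra of the compact-open topology. *)
Definition cylinders : set (set cpath) :=
  [set S | exists (t : R) (a : 'I_n) (A : set R),
     [/\ 0 <= t, measurable A & S = [set g : cpath | A (g t a)]]].

Definition Pathspace := g_sigma_algebraType cylinders.

(** Iterated Lebesgue integral over m real variables v 0, ..., v (m-1)
    (v 0 outermost); for non-negative integrands this is the integral
    with respect to Lebesgue measure on R^m (Tonelli). *)
Fixpoint iterint (m : nat) (f : (nat -> R) -> \bar R) : \bar R :=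
  match m with
  | 0 => f (fun _ => 0)
  | m'.+1 => (\int[@lebesgue_measure R]_(x in [set: R])
               iterint m' (fun v => f (fun i => if i is i'.+1 then v i' else x)))%E
  end.

Definition heat_kernel (s : R) (x y : 'I_n -> R) : R :=
  (4 * pi * s) `^ (- (n%:R / 2)) *
  expR (- (\sum_(a < n) (x a - y a) ^+ 2) / (4 * s)).

(** P is the Wiener measure (generator Delta, [W^a,W^b]_t = 2 t delta_ab):
    for 0 < t_0 < ... < t_{k-1} and Borel sets A j a, the probability that
    gamma_{t_j}^a \in A j a for all j < k, a < n equals
    int rho_{t_0}(0,dy_0) rho_{t_1-t_0}(y_0,dy_1) ... prod 1_{A j a}(y_j^a).
    The coordinate y_j^a is the variable number j*n+a. *)
Definition is_wiener_measure (P : probability Pathspace R) : Prop :=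
  forall (k : nat) (t : nat -> R) (A : nat -> 'I_n -> set R),
    0 < t 0 ->
    (forall j, (j.+1 < k)%N -> t j < t j.+1) ->
    (forall j a, measurable (A j a)) ->
    P [set g : Pathspace | forall j, (j < k)%N -> forall a : 'I_n, A j a (g (t j) a)]
    = iterint (n * k) (fun v =>
        let y j : 'I_n -> R := fun a => v (j * n + a)%N in
        let y' j : 'I_n -> R := if j is j'.+1 then y j' else (fun _ => 0) in
        let t' j : R := if j is j'.+1 then t j' else 0 in
        (\prod_(j < k) (heat_kernel (t j - t' j) (y' j) (y j) *
           \prod_(a < n) (\1_(A j a) (y j a) : R)))%:E).

Definition abs_cont_on (f : R -> R) (a b : R) : Prop :=
  forall e : R, 0 < e -> exists2 d : R, 0 < d &
    forall (m : nat) (u w : nat -> R),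
      (forall i, (i < m)%N -> a <= u i <= w i /\ w i <= b) ->
      (forall i j, (i < j < m)%N -> w i <= u j \/ w j <= u i) ->
      \sum_(i < m) (w i - u i) < d ->
      \sum_(i < m) `|f (w i) - f (u i)| < e.

Definition Hnorm2 (h : cpath) : \bar R :=
  (\int[@lebesgue_measure R]_(t in `[0%R, +oo[%classic)
     (\sum_(a < n) (derive1 (fun s => h s a) t) ^+ 2)%:E)%E.

Definition in_CM (h : cpath) : Prop :=
  (forall (a : 'I_n) (T : R), 0 < T -> abs_cont_on (fun s => h s a) 0 T) /\
  (Hnorm2 h < +oo)%E.

(** Phi_F(h) = ln (int F(gamma + h) dP(gamma)) + ||h||^2/4, in (-oo,+oo];
    the integral is +oo or a positive real. *)
Definition PhiF (P : probability Pathspace R) (F : Pathspace -> R) (h : cpath)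
  : \bar R :=
  match (\int[P]_(g in [set: Pathspace]) (F (path_add g h))%:E)%E with
  | r%:E => ((ln r)%:E + Hnorm2 h * (4^-1)%:E)%E
  | _ => +oo%E
  end.

End Paths.

(* Main.v *)
(** Write m_h for the law of gamma + h under the Wiener measure.  By the
    parallelogram identity for the Cameron-Martin norm, the claim is
      ln m_hl(F) <= l1 ln m_h1(F) + l2 ln m_h2(F) + (l1 l2 / 4) |h1 - h2|^2,
    hl := l1 h1 + l2 h2.  Linearising the geometric mean, it suffices to have,
    for every real th and with C := (l1 l2 / 4) |h1 - h2|^2,
      m_hl <= e^C (l1 e^(l2 th) m_h1 + l2 e^(- l1 th) m_h2)
    as measures, and then to choose th = ln m_h2(F) - ln m_h1(F).  No stochastic
    integral is needed for this: on a cylinder rectangle it is a pointwise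
    inequality between Gaussian densities, in which C appears as a bound for the
    discrete energy of h1 - h2 along the partition; finite boolean combinations
    of cylinders are disjoint unions of rectangles, and the monotone class
    theorem gives all measurable sets.  The discrete energy is bounded by
    |h1 - h2|^2 because an absolutely continuous function is the integral of its
    derivative: its variation is absolutely continuous, so the Stieltjes measures
    of its two monotone parts have densities (Radon-Nikodym), which are the
    derivatives almost everywhere (Lebesgue). *)

Require Import Defs.
From HB Require Import structures.
From mathcomp Require Import all_boot all_order all_algebra.
From mathcomp Require Import all_classical all_reals all_analysis.
From mathcomp Require Import measurable_realfun ring lra.
Import Order.TTheory GRing.Theory Num.Theory.
Import numFieldNormedType.Exports.
Local Open Scope classical_set_scope.
Local Open Scope ring_scope.

Set Implicit Arguments. Unset Strict Implicit. Unset Printing Implicit Defensive.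

(** * Absolutely continuous functions *)

Section AbsoluteContinuity.
Context {R : realType}.
Implicit Types (f G : R -> R) (p q : R * R) (L : seq (R * R)).

Definition nonoverlap p q := (p.2 <= q.1) || (q.2 <= p.1).

Definition within_itv a b p := (a <= p.1 <= p.2) && (p.2 <= b).

(** Lists replace indexed families so that intervals can be refined and concatenated by
    induction. *)
Lemma abs_cont_on_seq f a b : abs_cont_on f a b ->
  forall e, 0 < e -> exists2 d, 0 < d & forall L,
    all (within_itv a b) L -> pairwise nonoverlap L ->
    \sum_(p <- L) (p.2 - p.1) < d -> \sum_(p <- L) `|f p.2 - f p.1| < e.
Proof.
move=> acf e /acf[d d0 fd]; exists d => // L /allP aL pL.
rewrite !(big_nth (0, 0)) !big_mkord => sL.
apply: (fd _ (fun i => (nth (0, 0) L i).1) (fun i => (nth (0, 0) L i).2)) => //.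
  by move=> i iL; have /andP[? ?] := aL _ (mem_nth (0, 0) iL).
move=> i j /andP[ij jL]; apply/orP.
by apply: (pairwiseP (0, 0) pL) => //; rewrite inE (ltn_trans ij jL).
Qed.

Fixpoint steps (u : R) (s : seq R) : seq (R * R) :=
  if s is x :: s' then (u, x) :: steps x s' else [::].

Lemma steps_within_itv u s : path <%O u s -> all (within_itv u (last u s)) (steps u s).
Proof.
elim: s u => //= x s ih u /andP[ux xs].
have xl : x <= last x s.
  by apply: (@itv_partition_le _ R x (last x s) s); split.
rewrite /within_itv /= lexx (ltW ux) xl /=.
move: (ih _ xs); apply: sub_all => p /andP[/andP[h1 ->] ->].
by rewrite (le_trans (ltW ux) h1).
Qed.

Lemma steps_pairwise u s : path <%O u s -> pairwise nonoverlap (steps u s).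
Proof.
elim: s u => //= x s ih u /andP[ux xs]; rewrite ih// andbT.
move: (steps_within_itv xs); apply: sub_all => p /andP[/andP[h1 _] _].
by rewrite /nonoverlap /= h1.
Qed.

Lemma steps_length u s : \sum_(p <- steps u s) (p.2 - p.1) = last u s - u.
Proof.
elim: s u => /= [|x s ih] u; first by rewrite big_nil subrr.
by rewrite big_cons ih /=; ring.
Qed.

Lemma steps_variation b f u s :
  variation u b f s = \sum_(p <- steps u s) `|f p.2 - f p.1|.
Proof.
elim: s u => /= [|x s ih] u; first by rewrite variation_nil big_nil.
by rewrite big_cons -ih /variation /= big_nat_recl.
Qed.

Lemma nonoverlapC : symmetric nonoverlap.
Proof. by move=> p q; rewrite /nonoverlap orbC. Qed.

Lemma nonoverlap_within_itv p q r :
  within_itv p.1 p.2 q -> nonoverlap p r -> nonoverlap q r.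
Proof.
rewrite /nonoverlap => /andP[/andP[h1 h2] h3] /orP[h|h]; apply/orP.
  by left; exact: le_trans h.
by right; exact: le_trans h1.
Qed.

(** Induction on [L1]: the head interval is cut by an arbitrary partition, whose pieces join [L2]
    without changing the total length. The supremum over partitions then turns their increments into
    a total variation. *)
Lemma total_variation_sum_le f a b (d e : R) :
  (forall L, all (within_itv a b) L -> pairwise nonoverlap L ->
    \sum_(p <- L) (p.2 - p.1) < d -> \sum_(p <- L) `|f p.2 - f p.1| < e) ->
  forall L1 L2, all (within_itv a b) (L1 ++ L2) -> pairwise nonoverlap (L1 ++ L2) ->
    \sum_(p <- L1 ++ L2) (p.2 - p.1) < d ->
    (\sum_(p <- L1) total_variation p.1 p.2 f +
       (\sum_(p <- L2) `|f p.2 - f p.1|)%:E <= e%:E)%E.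
Proof.
move=> H; elim=> [|p L1 ih] L2.
  move=> aL pL sL; rewrite big_nil add0e lee_fin ltW//; exact: H.
rewrite cat_cons => /= /andP[abp aL] /andP[pL pwL]; rewrite !big_cons => sL.
have lenp : 0 <= p.2 - p.1 by move: abp => /andP[/andP[_ ?] _]; rewrite subr_ge0.
have S1ge0 : (0 <= \sum_(j <- L1) total_variation j.1 j.2 f)%E.
  rewrite big_seq; apply: sume_ge0 => j jL; apply: total_variation_ge0.
  move: aL; rewrite all_cat => /andP[/allP aL _].
  by have /andP[/andP[]] := aL _ jL.
set S1 := (\sum_(j <- L1) _)%E in S1ge0 *; set D2 := \sum_(j <- L2) _.
have S1D2 : (S1 + D2%:E <= e%:E)%E.
  by apply: ih => //; rewrite (le_lt_trans _ sL)// lerDr.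
have S1fin : S1 \is a fin_num.
  rewrite ge0_fin_numE//; apply: le_lt_trans (ltry e).
  by apply: le_trans S1D2; rewrite leeDl// lee_fin; apply: sumr_ge0.
suff : (total_variation p.1 p.2 f <= e%:E - D2%:E - S1)%E.
  by rewrite leeBrDr// leeBrDr.
apply: ge_ereal_sup => _ [_ [s [ps /eqP lps] <-] <-].
rewrite leeBrDr// leeBrDr// addeAC addeC addeA -addeA -EFinD addrC steps_variation.
rewrite addrC -big_cat/=.
have sub := steps_within_itv ps; rewrite lps in sub.
have mem q : q \in steps p.1 s -> within_itv p.1 p.2 q by move/(allP sub).
apply: ih.
- rewrite all_cat in aL; case/andP: aL => aL1 aL2.
  rewrite !all_cat aL1 aL2 /= andbT; move: sub; apply: sub_all => q /andP[/andP[h1 h2] h3].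
  move: abp => /andP[/andP[k1 k2] k3].
  by rewrite /within_itv (le_trans k1 h1) h2 (le_trans h3 k3).
- move: pwL; rewrite pairwise_cat => /and3P[r12 r1 r2].
  rewrite pairwise_cat r1 /= allrel_catr r12 andbT; apply/andP; split.
    apply/allrelP => x y xL yL; rewrite nonoverlapC.
    apply: nonoverlap_within_itv (mem _ yL) _.
    by move: pL => /allP; apply; rewrite mem_cat xL.
  rewrite pairwise_cat r2 steps_pairwise// !andbT; apply/allrelP => x y xL yL.
  apply: nonoverlap_within_itv (mem _ xL) _.
  by move: pL => /allP; apply; rewrite mem_cat yL orbT.
- move: sL; rewrite !big_cat/= steps_length lps; apply: le_lt_trans.
  by rewrite addrCA.
Qed.

Lemma abs_cont_on_total_variation_sum f a b : abs_cont_on f a b ->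
  forall e, 0 < e -> exists2 d, 0 < d & forall L,
    all (within_itv a b) L -> pairwise nonoverlap L ->
    \sum_(p <- L) (p.2 - p.1) < d ->
    (\sum_(p <- L) total_variation p.1 p.2 f <= e%:E)%E.
Proof.
move=> /abs_cont_on_seq acf e /acf[d d0 fd]; exists d => // L aL pL sL.
have := @total_variation_sum_le f a b d e fd L [::].
by rewrite cats0 big_nil adde0; exact.
Qed.

(** With the [d] that belongs to [e = 1], finitely many steps of length [d / 2] lead from [a] to
    [x], and each adds at most 1 to the variation; [k] counts the steps. *)
Lemma abs_cont_on_bounded_variation f a b : abs_cont_on f a b ->
  forall x, a <= x <= b -> total_variation a x f \is a fin_num.
Proof.
move=> /abs_cont_on_total_variation_sum /(_ _ ltr01)[d d0 fd] x /andP[ax xb].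
have d20 : 0 < d / 2 by rewrite divr_gt0.
suff main k : forall y, a <= y <= b -> y <= a + k%:R * (d / 2) ->
    total_variation a y f \is a fin_num.
  apply: (main (Num.bound ((x - a) / (d / 2)))); first by rewrite ax.
  rewrite -lerBlDl -ler_pdivrMr// ltW//.
  by apply: archi_boundP; rewrite divr_ge0 ?subr_ge0// ltW.
elim: k => [|k ih] y /andP[ay yb].
  rewrite mul0r addr0 => ya; have -> : y = a by apply/eqP; rewrite eq_le ya ay.
  by rewrite total_variationxx.
move=> yk; have [/ih|] := leP y (a + k%:R * (d / 2)); first by apply; rewrite ay.
set z := a + _ => zy.
have az : a <= z by rewrite lerDl mulr_ge0// ltW.
have zb : z <= b by rewrite ltW// (lt_le_trans zy).
rewrite (total_variationD f az (ltW zy)) fin_numD ih ?az//=.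
rewrite ge0_fin_numE ?total_variation_ge0 ?(ltW zy)//.
apply: le_lt_trans (ltry 1).
have := fd [:: (z, y)]; rewrite !big_seq1 /=; apply => //.
  by rewrite /within_itv /= az (ltW zy) yb.
rewrite ltrBlDl (le_lt_trans yk)// /z -addrA ltrD2l -natr1 mulrDl mul1r ltrD2l.
by rewrite ltr_pdivrMr// mulr2n mulrDr mulr1 ltrDl.
Qed.

End AbsoluteContinuity.

(** * Densities of monotone absolutely continuous functions *)

Section MonotoneDensity.
Context {R : realType}.
Notation mu := (@lebesgue_measure R).
Variables (G : R -> R) (a b : R).
Hypothesis ndG : {homo G : x y / x <= y}.
Hypothesis Ga : forall x, x <= a -> G x = G a.
Hypothesis Gb : forall x, b <= x -> G x = G b.
Hypothesis acG : forall e, 0 < e -> exists2 d, 0 < d & forall L,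
    all (fun p : R * R => p.1 <= p.2) L -> pairwise nonoverlap L ->
    \sum_(p <- L) (p.2 - p.1) < d -> \sum_(p <- L) (G p.2 - G p.1) < e.

Lemma ac_right_continuous : right_continuous G.
Proof.
move=> x; apply/cvgrPdist_lt => e /acG[d d0 Gd].
near=> y.
have xy : x < y by near: y; exact: nbhs_right_gt.
have yxd : y - x < d.
  by rewrite ltrBlDl; near: y; apply: nbhs_right_lt; rewrite ltrDl.
rewrite distrC ger0_norm ?subr_ge0 ?ndG// ?ltW//.
by have := Gd [:: (x, y)]; rewrite !big_seq1/= (ltW xy); apply.
Unshelve. all: by end_near. Qed.

Let Gc : cumulative R R :=
  HB.pack G (isCumulative.Build R _ R G ndG ac_right_continuous).

Local Notation nu := (lebesgue_stieltjes_measure Gc).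

Let nu_oc x y : x <= y -> nu `]x, y]%classic = (G y - G x)%:E.
Proof.
move=> xy; rewrite /lebesgue_stieltjes_measure /measure_extension.
by rewrite measurable_mu_extE/=; [rewrite wlength_itv_bnd|exact: is_ocitv].
Qed.

(** Since [G] is constant outside [[a, b]], each []-n, n]] has mass at most [G b - G a]. *)
Let nu_fin : fin_num_fun nu.
Proof.
apply: lty_fin_num_fun.
have : (nu \o (fun n : nat => `]- (n%:R), n%:R]%classic)) n @[n --> \oo] -->
    nu (\bigcup_n `]- (n%:R), n%:R]%classic).
  apply: nondecreasing_cvg_mu => //; first exact: bigcup_measurable.
  by move=> *; apply/subsetPset/subset_itv; rewrite leBSide/= ?lerN2 ler_nat.
rewrite (bigcup_itvT false false) => nu_cvg.
have nuE := cvg_lim (@ereal_hausdorff R) nu_cvg.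
suff : (nu [set: R] <= (G b - G a)%:E)%E by move=> /le_lt_trans; apply; exact: ltry.
rewrite -[leLHS]nuE.
apply: lime_le; first by apply/cvg_ex; eexists; exact: nu_cvg.
near=> n; rewrite /= nu_oc ?ge0_cp// lee_fin lerB//.
  have [nb|/ltW bn] := leP n%:R b; first exact: ndG.
  by rewrite (Gb bn).
have [an|/ltW na] := leP a (- n%:R); first exact: ndG.
by rewrite (Ga na).
Unshelve. all: by end_near. Qed.

Let nuf : {finite_measure set (measurableTypeR R) -> \bar R} :=
  HB.pack nu (Measure_isFinite.Build _ _ _ nu nu_fin).


(** Components of an open set of finite measure have two real endpoints, to which [acG] can be
    applied; the empty set becomes []0, 0[]. *)
Let open_interval_bnd (I : set R) : open I -> is_interval I -> (mu I < +oo)%E ->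
  exists2 p : R * R, p.1 <= p.2 & I = `]p.1, p.2[%classic.
Proof.
move=> oI iI muI; have [->|/set0P[c Ic]] := eqVneq I set0.
  by exists (0, 0) => //=; rewrite set_itvoo0.
have II : I = I^°%classic by apply/esym/interior_id.
have [ub|nub] := pselect (has_ubound I); have [lb|nlb] := pselect (has_lbound I).
- exists (inf I, sup I).
    by rewrite (@le_trans _ _ c)//; [exact: ge_inf|exact: ub_le_sup].
  by rewrite [LHS]II interval_bounded_interior// set_itvoo.
- move: muI; rewrite [X in (mu X < _)%E]II interval_left_unbounded_interior// -set_itvNyo.
  by rewrite lebesgue_measure_itv/= ?ltNyr ?ltry/= ?ltxx.
- move: muI; rewrite [X in (mu X < _)%E]II interval_right_unbounded_interior// -set_itvoy.
  by rewrite lebesgue_measure_itv/= ?ltNyr ?ltry/= ?ltxx.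
- move: muI; rewrite (interval_unbounded_setT iI nlb nub).
  by rewrite -set_itvNyy lebesgue_measure_itv.
Qed.

(** An open set is a countable disjoint union of open intervals; [acG] bounds the increments of [G]
    over any finitely many of them, and sigma-additivity passes to the whole set. *)
Let nu_open_lt (e : R) : 0 < e -> exists2 d, 0 < d &
  forall U : set R, open U -> (mu U < d%:E)%E -> (nu U <= e%:E)%E.
Proof.
move=> /acG[d d0 Gd]; exists d => // U oU Ud.
pose I := open_disjoint_itv oU.
have mI k : measurable (I k).
  by apply: open_measurable; exact: open_disjoint_itv_open.
have IU k : I k `<=` U.
  by move=> x Ix; rewrite (open_disjoint_itv_bigcup oU); exists k.
have /all_sig2[p p12 Ip] : forall k, {p : R * R | p.1 <= p.2 & I k = `]p.1, p.2[%classic}.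
  move=> k; apply: cid2; apply: open_interval_bnd.
  - exact: open_disjoint_itv_open.
  - exact: open_disjoint_itv_is_interval.
  - apply: le_lt_trans (lt_trans Ud (ltry _)).
    by apply: le_measure; rewrite ?inE; [exact: mI|exact: open_measurable|exact: IU].
(* Degenerate intervals are filtered out: they contribute nothing, but one lying inside another
   interval would violate [nonoverlap]. *)
have sumE (h : R -> R) m : \sum_(q <- [seq p i | i <- iota 0 m & (p i).1 < (p i).2])
     (h q.2 - h q.1) = \sum_(i < m) (h (p i).2 - h (p i).1).
  rewrite big_map big_filter -(big_mkord xpredT (fun i => h (p i).2 - h (p i).1)).
  rewrite [in RHS]/index_iota subn0 big_mkcond; apply: eq_bigr => i _.
  case: ifPn => //; rewrite -leNgt => h1.
  have -> : (p i).1 = (p i).2 by apply/eqP; rewrite eq_le p12.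
  by rewrite subrr.
have Itriv : trivIset setT I by exact: open_disjoint_itv_trivIset.
have main m : \sum_(i < m) (G (p i).2 - G (p i).1) < e.
  rewrite -sumE; apply: Gd.
  - by apply/allP => q /mapP[i _ ->].
  - rewrite pairwise_map.
    apply: (@sub_in_pairwise _ (fun i => (p i).1 < (p i).2) ltn); last first.
    + by apply: pairwise_filter; rewrite -sorted_pairwise;
        [exact: iota_ltn_sorted|exact: ltn_trans].
    + exact: filter_all.
    move=> i j; rewrite /in_mem/= => pi pj ij.
    (* Two overlapping intervals would share the midpoint [z] of their intersection. *)
    rewrite /= /nonoverlap; apply/negPn/negP; rewrite negb_or -!ltNge => /andP[ji ij'].
    have ltc : Num.max (p i).1 (p j).1 < Num.min (p i).2 (p j).2.
      by rewrite gt_max !lt_min pi pj ji ij'.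
    pose z := (Num.max (p i).1 (p j).1 + Num.min (p i).2 (p j).2) / 2.
    have z1 := midf_lt ltc; case: z1 => z1 z2.
    move/trivIsetP : Itriv => /(_ i j Logic.I Logic.I (negbT (ltn_eqF ij))).
    rewrite -subset0 => /(_ z); apply; rewrite !Ip; move: z1 z2.
    by rewrite gt_max lt_min /= !in_itv/= => /andP[-> ->] /andP[-> ->].
  - rewrite (sumE id) -lte_fin; apply: le_lt_trans Ud.
    rewrite (_ : _%:E = \sum_(i < m) mu (I i))%E; last first.
      rewrite -sumEFin; apply: eq_bigr => i _.
      rewrite Ip lebesgue_measure_itv/= lte_fin lt_neqAle p12 andbT.
      by case: eqVneq => [->|//]; rewrite subrr.
    have mbI : measurable (\big[setU/set0]_(i < m) I i) by exact: bigsetU_measurable.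
    rewrite -measure_semi_additive_ord_I; last 3 first.
    + by move=> k _; exact: mI.
    + exact: sub_trivIset Itriv.
    + exact: mbI.
    apply: le_measure; rewrite ?inE.
    + exact: mbI.
    + exact: open_measurable.
    + by rewrite -bigcup_mkord; exact: bigcup_sub.
rewrite (open_disjoint_itv_bigcup oU).
have nuI : (fun n => \sum_(0 <= i < n) nu (I i))%E @ \oo --> nu (\bigcup_n I n).
  exact: measure_sigma_additive.
have nuE := cvg_lim (@ereal_hausdorff R) nuI.
rewrite -[leLHS]nuE; apply: lime_le; first by apply/cvg_ex; eexists; exact: nuI.
apply: nearW => m; rewrite big_mkord.
apply: (@le_trans _ _ (\sum_(i < m) (G (p i).2 - G (p i).1)%:E)%E).
  apply: lee_sum => i _; rewrite -nu_oc//; apply: le_measure; rewrite ?inE.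
  - exact: mI.
  - exact: measurable_itv.
  - by rewrite Ip; exact: subset_itv_oo_oc.
by rewrite sumEFin lee_fin ltW.
Qed.

(** Outer regularity encloses a null set in open sets of arbitrarily small Lebesgue measure, hence
    of small [nu]-measure. *)
Let nu_dominated : nuf `<< mu.
Proof.
apply/null_content_dominatesP => N mN muN.
apply/eqP; rewrite eq_le measure_ge0 andbT.
apply/lee_addgt0Pr => e e0; rewrite add0e.
have [d d0 nud] := nu_open_lt e0.
have [U [oU NU Ud]] : exists U : set R, [/\ open U, N `<=` U & (mu (U `\` N) < d%:E)%E].
  by apply: lebesgue_regularity_outer; rewrite ?muN.
apply: le_trans (nud U oU _).
  by apply: le_measure; rewrite ?inE//; exact: open_measurable.
have -> : U = N `|` (U `\` N) by rewrite setDUK.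
rewrite measureU//; last 2 first.
- by apply: measurableD => //; exact: open_measurable.
- by rewrite setDIK.
by rewrite muN add0e.
Qed.

(** The density is the Radon-Nikodym derivative of the Stieltjes measure of [G]; its values are
    finite, so [fine] loses nothing. *)
Lemma ac_nondecreasing_density : exists2 g : R -> R,
  mu.-integrable setT (EFin \o g) &
  forall x y, x <= y -> G y - G x = \int[mu]_(t in `]x, y]) g t.
Proof.
have [g [g0 gfin intg nug]] := radon_nikodym_sigma_finite nu_dominated.
have gE : EFin \o (fine \o g) = g.
  by apply/funext => t; rewrite /= fineK.
exists (fine \o g); first by rewrite gE.
move=> x y xy; rewrite /Rintegral.
under eq_integral do rewrite /= fineK//.
by rewrite -nug// [nuf _]nu_oc.
Qed.

End MonotoneDensity.

(** * Densities and derivatives of absolutely continuous functions *)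

Section AbsolutelyContinuousDensity.
Context {R : realType}.
Notation mu := (@lebesgue_measure R).
Variables (f : R -> R) (a b : R).
Hypotheses (ab : a <= b) (acf : abs_cont_on f a b).

(** Precomposing with this clamp gives functions on the line that are constant outside [[a, b]], as
    the monotone case requires. *)
Let clip x : R := Num.max a (Num.min x b).

Let clip_itv x : a <= clip x <= b.
Proof. by rewrite /clip le_max lexx ge_max ab ge_min lexx orbT. Qed.

Let clip_homo : {homo clip : x y / x <= y}.
Proof. by move=> x y xy; rewrite /clip /Num.max /Num.min; do ! case: ifP; lra. Qed.

Let clipE x : a <= x <= b -> clip x = x.
Proof. by move=> /andP[ax xb]; rewrite /clip min_l// max_r. Qed.

Let clip_lip x y : x <= y -> clip y - clip x <= y - x.
Proof.
move=> xy; rewrite /clip /Num.max /Num.min.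
by do ! case: ifP; lra.
Qed.

Let V x : R := fine (total_variation a (clip x) f).

Let TVfin x : total_variation a (clip x) f \is a fin_num.
Proof. exact: (abs_cont_on_bounded_variation acf). Qed.

Let VB x y : x <= y ->
  (V y - V x)%:E = total_variation (clip x) (clip y) f.
Proof.
move=> xy; have /andP[ax _] := clip_itv x.
have D := total_variationD f ax (clip_homo xy).
have : total_variation (clip x) (clip y) f \is a fin_num.
  by have := TVfin y; rewrite D fin_numD => /andP[].
by move=> fin; rewrite /V EFinB !fineK ?TVfin// D addeAC subee ?TVfin// add0e.
Qed.

Let V_ge x y : x <= y -> `|f (clip y) - f (clip x)| <= V y - V x.
Proof.
by move=> xy; rewrite -lee_fin VB//; apply: total_variation_ge; exact: clip_homo.
Qed.

(** Increments of [V] are total variations over clamped intervals, and clamping keeps intervals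
    non-overlapping without lengthening them. *)
Let V_ac e : 0 < e -> exists2 d, 0 < d & forall L,
    all (fun p : R * R => p.1 <= p.2) L -> pairwise nonoverlap L ->
    \sum_(p <- L) (p.2 - p.1) < d -> \sum_(p <- L) (V p.2 - V p.1) <= e.
Proof.
move=> /(abs_cont_on_total_variation_sum acf)[d d0 fd].
exists d => // L aL pL sL.
pose L' := [seq (clip p.1, clip p.2) | p <- L].
have /fd : all (within_itv a b) L'.
  rewrite all_map; apply: sub_all aL => p /= p12.
  rewrite /within_itv/= clip_homo// andbT.
  by have /andP[-> _] := clip_itv p.1; have /andP[_ ->] := clip_itv p.2.
have /[swap]/[apply] : pairwise nonoverlap L'.
  rewrite pairwise_map; apply: sub_pairwise pL => p q.
  by rewrite /nonoverlap /= => /orP[/clip_homo ->//|/clip_homo ->]; rewrite orbT.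
rewrite !big_map -lee_fin -sumEFin => H.
rewrite big_seq (eq_bigr (fun p => total_variation (clip p.1) (clip p.2) f)); last first.
  by move=> p pL'; rewrite VB//; exact: (allP aL).
rewrite -big_seq; apply: H; apply: le_lt_trans sL.
rewrite big_seq [leRHS]big_seq; apply: ler_sum => p pL'.
by apply: clip_lip; exact: (allP aL).
Qed.

(** Jordan decomposition: on [[a, b]], [f = V - (V - f)], where both terms are nondecreasing and
    absolutely continuous. *)
Lemma abs_cont_on_density : exists2 g : R -> R,
  mu.-integrable setT (EFin \o g) &
  forall x y, a <= x -> x <= y -> y <= b ->
    f y - f x = \int[mu]_(t in `]x, y]) g t.
Proof.
have Vhomo : {homo V : x y / x <= y}.
  by move=> x y /V_ge h; rewrite -subr_ge0; exact: le_trans h.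
have clipa x : x <= a -> clip x = clip a.
  by move=> xa; rewrite /clip !max_l// ?ge_min ?xa ?lexx.
have clipb x : b <= x -> clip x = clip b.
  by move=> bx; rewrite /clip !min_r.
have [g1 ig1 g1E] : exists2 g : R -> R, mu.-integrable setT (EFin \o g) &
    forall x y, x <= y -> V y - V x = \int[mu]_(t in `]x, y]) g t.
  apply: (@ac_nondecreasing_density _ V a b) => //.
  - by move=> x xa; rewrite /V clipa.
  - by move=> x bx; rewrite /V clipb.
  (* [V_ac] yields a weak inequality; halving makes it strict. *)
  - move=> e e0; have e20 : 0 < e / 2 by rewrite divr_gt0.
    have [d d0 Vd] := V_ac e20; exists d => // L aL pL sL.
    by rewrite (le_lt_trans (Vd _ aL pL sL))// ltr_pdivrMr// ltr_pMr// ltr1n.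
have [g2 ig2 g2E] : exists2 g : R -> R, mu.-integrable setT (EFin \o g) &
    forall x y, x <= y -> (V y - f (clip y)) - (V x - f (clip x)) =
      \int[mu]_(t in `]x, y]) g t.
  apply: (@ac_nondecreasing_density _ (fun x => V x - f (clip x)) a b) => //.
  - move=> x y /V_ge; rewrite ler_norml => /andP[_]; lra.
  - by move=> x xa; rewrite /V clipa.
  - by move=> x bx; rewrite /V clipb.
  (* Increments of [V - f] are at most twice those of [V], so [e / 4] leaves [e / 2 < e]. *)
  - move=> e e0; have e40 : 0 < e / 4 by rewrite divr_gt0.
    have [d d0 Vd] := V_ac e40; exists d => // L aL pL sL.
    apply: (@le_lt_trans _ _ (\sum_(p <- L) (V p.2 - V p.1) * 2)); last first.
      rewrite -mulr_suml; have := Vd _ aL pL sL; lra.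
    rewrite big_seq [leRHS]big_seq; apply: ler_sum => p /(allP aL)/V_ge.
    rewrite ler_norml => /andP[]; lra.
have ig A : measurable A -> mu.-integrable A (EFin \o g1) /\ mu.-integrable A (EFin \o g2).
  by move=> mA; split; [apply: integrableS ig1|apply: integrableS ig2].
exists (fun t => g1 t - g2 t).
  exact: (integrableB measurableT ig1 ig2).
move=> x y ax xy yb; have [ixy1 ixy2] := ig _ (measurable_itv `]x, y]).
rewrite RintegralB// -g1E// -g2E// (clipE (x := x)) ?ax ?(le_trans xy)//.
by rewrite (clipE (x := y)) ?yb ?(le_trans ax)//; ring.
Qed.

(** Lebesgue differentiation applies to the primitive of [g] from [a], which differs from [f] by the
    constant [f a]. *)
Lemma abs_cont_on_ae_derivable : exists2 g : R -> R,
  mu.-integrable setT (EFin \o g) &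
  (forall x y, a <= x -> x <= y -> y <= b ->
    f y - f x = \int[mu]_(t in `]x, y]) g t) /\
  {ae mu, forall t, a < t < b -> derivable f t 1 /\ derive1 f t = g t}.
Proof.
have [g ig gE] := abs_cont_on_density; exists g => //; split => //.
have locg : locally_integrable setT g.
  by apply: open_integrable_locally => //; exact: openT.
have igy y : mu.-integrable [set` Interval (BRight a) (BRight y)] (EFin \o g).
  by apply: integrableS ig => //; exact: measurable_itv.
have := FTC1 igy locg.
set F := fun x => _; apply: filterS; first exact: (ae_filter_ringOfSetsType mu).
move=> t Ft /andP[at_ tb].
have [dF FE] := Ft at_.
have fF : \forall s \near t, f a + F s = f s.
  near=> s; have as_ : a < s by near: s; exact: lt_nbhsr.
  rewrite /F -gE//; [by rewrite addrC subrK|exact: ltW|].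
  by apply/ltW; near: s; exact: lt_nbhsl.
have dcF : derivable (fun s => f a + F s) t 1.
  by apply: derivableD => //; exact: derivable_cst.
split; first exact: near_eq_derivable dcF.
rewrite derive1E -(near_eq_derive _ fF) deriveD; [|exact: derivable_cst|exact: dF].
by rewrite derive_cst add0r -derive1E.
Unshelve. all: by end_near. Qed.

End AbsolutelyContinuousDensity.

(** * The Cameron-Martin norm *)

Section NullSetIntegral.
Context d (T : measurableType d) (R : realType).
Variable mu : {measure set T -> \bar R}.
Import HBNNSimple.

(* No measurability of the integrands: the integral of a non-negative function
   is the supremum of the integrals of the simple functions below it, and a
   simple function may be set to 0 on a null set. *)
Lemma ge0_le_integral_off_null (D N : set T) (f1 f2 : T -> \bar R) :
  measurable N -> mu N = 0%E ->
  (forall x, D x -> (0 <= f1 x)%E) -> (forall x, D x -> (0 <= f2 x)%E) ->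
  (forall x, D x -> ~ N x -> (f1 x <= f2 x)%E) ->
  (\int[mu]_(x in D) f1 x <= \int[mu]_(x in D) f2 x)%E.
Proof.
move=> mN muN f10 f20 f12; rewrite !ge0_integralE//.
apply: ge_ereal_sup => _ [h hf <-].
pose h' := proj_nnsfun h (measurableC mN).
apply: ereal_sup_ubound; exists h'.
  move=> x /=; rewrite mindicE; have [xN|xN] := boolP (x \in ~` N).
    rewrite mulr1; apply: le_trans (hf x) _; rewrite !patchE.
    case: ifPn => // xD; apply: f12; [exact: set_mem|exact: (set_mem xN)].
  rewrite mulr0 patchE; case: ifPn => // xD; apply: f20; exact: set_mem.
rewrite -!integralT_nnsfun; apply: ge0_ae_eq_integral => //.
- by apply/measurable_EFinP.
- by apply/measurable_EFinP.
- by move=> x _; rewrite lee_fin.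
- by move=> x _; rewrite lee_fin.
exists N; split => // x /= hx; apply: contrapT => xN; apply: hx => _.
by rewrite mindicE mem_set// mulr1.
Qed.

Lemma ge0_eq_integral_off_null (D N : set T) (f1 f2 : T -> \bar R) :
  measurable N -> mu N = 0%E ->
  (forall x, D x -> (0 <= f1 x)%E) -> (forall x, D x -> (0 <= f2 x)%E) ->
  (forall x, D x -> ~ N x -> f1 x = f2 x) ->
  (\int[mu]_(x in D) f1 x = \int[mu]_(x in D) f2 x)%E.
Proof.
move=> mN muN f10 f20 f12; apply/eqP; rewrite eq_le; apply/andP.
by split; apply: (ge0_le_integral_off_null mN muN) => // x Dx xN; rewrite f12.
Qed.

End NullSetIntegral.

(** * Measurable derivatives of paths and discrete energy *)

Section PathDensity.
Context {R : realType} {n : nat}.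
Notation mu := (@lebesgue_measure R).
Implicit Types (h : cpath R n) (g : 'I_n -> R -> R).

Lemma measurable_itvR (i : interval R) : measurable ([set` i] : set (measurableTypeR R)).
Proof. exact: measurable_itv. Qed.

(** [g] is a measurable substitute for the derivative in [Hnorm2]. Integrability is asked on bounded
    intervals only, since a square-integrable derivative need not be integrable on the half-line. *)
Definition path_density h g := forall a : 'I_n,
  [/\ measurable_fun setT (g a),
    (forall x y, 0 <= x <= y -> mu.-integrable `]x, y] (EFin \o g a) /\
      h y a - h x a = \int[mu]_(t in `]x, y]) g a t) &
    {ae mu, forall t, 0 < t ->
      derivable (fun s => h s a) t 1 /\ derive1 (fun s => h s a) t = g a t}].

Lemma path_measurable h a : measurable_fun setT (fun t => h t a).
Proof.
have -> : [set: R] = `]-oo, 0[%classic `|` `[0, +oo[%classic.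
  by rewrite -setCitvr setUC setUCr.
apply/measurable_funU => //; case: h => h [h0 hn hc] /=; split.
  have : measurable_fun (`]-oo, 0[%classic : set R) (cst 0 : R -> R) by exact: measurable_cst.
  apply: eq_measurable_fun.
  by move=> t; rewrite inE/= in_itv/= => t0; rewrite hn.
by apply: subspace_continuous_measurable_fun => //; exact: hc.
Qed.

Let quot (f : R -> R) (t : R) (k : nat) : R :=
  k.+1%:R * (f (t + k.+1%:R^-1) - f t).

(** An upper limit of difference quotients is measurable, is defined at every point, and equals the
    derivative wherever that exists. It is thus a common version of the densities found on different
    bounded intervals. *)
Let rderiv (f : R -> R) (t : R) : R := fine (limn_esup (EFin \o quot f t)).

Let measurable_rderiv (f : R -> R) : measurable_fun setT f -> measurable_fun setT (rderiv f).
Proof.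
move=> mf; apply: measurableT_comp => //.
apply: measurable_fun_limn_esup => k; apply/measurable_EFinP.
apply: measurable_funM => //; apply: measurable_funB => //.
by apply: measurableT_comp => //; exact: measurable_funD.
Qed.

Let rderivE (f : R -> R) (t : R) : derivable f t 1 -> rderiv f t = derive1 f t.
Proof.
move=> df; rewrite /rderiv.
suff qf : quot f t k @[k --> \oo] --> derive1 f t.
  have qfE : (EFin \o quot f t) k @[k --> \oo] --> (derive1 f t)%:E.
    by apply/fine_cvgP; split => //; exact: nearW.
  rewrite is_cvg_limn_esupE; last by apply/cvg_ex; eexists; exact: qfE.
  by rewrite (cvg_lim _ qfE).
have /cvg_dnbhs_at_right/cvg_at_rightP :
    h^-1 *: (f (h + t) - f t) @[h --> 0^'] --> derive1 f t.
  rewrite /derive1 (_ : (fun z => _) =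
    (fun z : R => z^-1 *: ((f \o shift t) (z *: (1 : R)) - f t))); first exact: df.
  by apply/funext => z /=; rewrite [z *: _]mulr1.
move=> /(_ (fun k => k.+1%:R^-1)) H.
apply: cvg_trans (H _); last by split => //; exact: cvg_harmonic.
apply: near_eq_cvg; near=> k.
by rewrite /quot /= invrK [_^-1 + t]addrC.
Unshelve. all: by end_near. Qed.

Lemma in_CM_path_density h : in_CM h -> exists g, path_density h g.
Proof.
move=> [ach _]; exists (fun a => rderiv (fun t => h t a)) => a.
set f := fun t => h t a.
have T0 k : 0 < k.+1%:R :> R by [].
(* Absolute continuity is local, so a density is obtained for each [[0, k + 1]]; on that interval it
   agrees almost everywhere with [rderiv f]. *)
have loc k : exists2 g : R -> R,
    mu.-integrable setT (EFin \o g) &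
    (forall x y, 0 <= x -> x <= y -> y <= k.+1%:R ->
      f y - f x = \int[mu]_(t in `]x, y]) g t) /\
    {ae mu, forall t, 0 < t < k.+1%:R -> derivable f t 1 /\ derive1 f t = g t}.
  exact: (abs_cont_on_ae_derivable (ltW (T0 k)) (ach a _ (T0 k))).
have mg : measurable_fun setT (rderiv f) by apply: measurable_rderiv; exact: path_measurable.
split => //; last first.
  have : {ae mu, forall t, forall k : nat, 0 < t < k.+1%:R -> derivable f t 1}.
    apply/ae_foralln => k; have [g _ [_]] := loc k.
    apply: filterS; first exact: (ae_filter_ringOfSetsType mu).
    by move=> t + tk => /(_ tk)[].
  apply: filterS; first exact: (ae_filter_ringOfSetsType mu).
  move=> t dt t0; have df : derivable f t 1.
    apply: (dt (Num.bound t)); rewrite t0 /=.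
    by rewrite (lt_trans (archi_boundP (ltW t0)))// ltr_nat.
  by split => //; rewrite rderivE.
move=> x y /andP[x0 xy].
pose k := Num.bound y; have yk : y < k.+1%:R.
  by rewrite (lt_trans (archi_boundP (le_trans x0 xy)))// ltr_nat.
have [g ig [gE gae]] := loc k.
have aeq : ae_eq mu `]x, y]%classic (EFin \o g) (EFin \o rderiv f).
  move: gae; apply: filterS; first exact: (ae_filter_ringOfSetsType mu).
  move=> t H /=; rewrite in_itv/= => /andP[xt ty].
  have [|df <-] := H; first by rewrite (le_lt_trans x0 xt) (le_lt_trans ty).
  by rewrite rderivE.
have igxy : mu.-integrable `]x, y] (EFin \o g) by apply: integrableS ig.
have igrd : mu.-integrable `]x, y] (EFin \o rderiv f).
  have mrd : measurable_fun (`]x, y]%classic : set R) (EFin \o rderiv f).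
    by apply/measurable_EFinP; exact: measurable_funS mg.
  apply/integrableP; split; first exact: mrd.
  case/integrableP : igxy => mgxy; apply: le_lt_trans.
  rewrite le_eqVlt; apply/orP; left; apply/eqP/esym/ae_eq_integral => //.
  - exact: measurableT_comp.
  - exact: measurableT_comp.
  - exact: ae_eq_comp aeq.
split; first exact: igrd.
rewrite gE// ?(ltW yk)// /Rintegral; congr fine.
by apply: ae_eq_integral => //; apply: measurable_int; eassumption.
Qed.

Lemma path_density_lin l1 l2 h1 h2 g1 g2 :
  path_density h1 g1 -> path_density h2 g2 ->
  path_density (path_lin l1 l2 h1 h2) (fun a t => l1 * g1 a t + l2 * g2 a t).
Proof.
move=> d1 d2 a; have [m1 i1 D1] := d1 a; have [m2 i2 D2] := d2 a; split.
- by apply: measurable_funD; apply: measurable_funM.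
- move=> x y xy; have mI := measurable_itvR `]x, y].
  have [ig1 e1] := i1 x y xy; have [ig2 e2] := i2 x y xy.
  have ig1' := integrableZl mI l1 ig1.
  have ig2' := integrableZl mI l2 ig2.
  split; first exact: (integrableD mI ig1' ig2').
  rewrite RintegralD// !RintegralZl// -e1 -e2 /=; ring.
- move: D1 D2; apply: filterS2; first exact: (ae_filter_ringOfSetsType mu).
  move=> t D1 D2 t0; have [p1 q1] := D1 t0; have [p2 q2] := D2 t0.
  have H1 : is_derive t 1 (fun s => h1 s a) (g1 a t) by split; rewrite // -derive1E.
  have H2 : is_derive t 1 (fun s => h2 s a) (g2 a t) by split; rewrite // -derive1E.
  have [p q] := is_deriveD (is_deriveZ l1 H1) (is_deriveZ l2 H2).
  by split; [exact: p|rewrite derive1E; exact: q].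
Qed.

Lemma Hnorm2_density h g : path_density h g ->
  Hnorm2 h = (\int[mu]_(t in `[0%R, +oo[%classic) (\sum_(a < n) (g a t) ^+ 2)%:E)%E.
Proof.
move=> dh.
have : {ae mu, forall t, forall a : 'I_n, 0 < t -> derive1 (fun s => h s a) t = g a t}.
  apply: (filter_forall (ae_filter_ringOfSetsType mu)).
  move=> a; have [_ _] := dh a.
  apply: filterS; first exact: (ae_filter_ringOfSetsType mu).
  by move=> t H /H[].
move=> [N [mN muN sN]].
(* The point 0 joins the exceptional set because the derivative is controlled only for [t > 0]. *)
apply: (@ge0_eq_integral_off_null _ _ _ _ _ (N `|` [set 0])).
- exact: measurableU.
- apply/eqP; rewrite eq_le measure_ge0 andbT.
  have m0 : measurable ([set 0] : set (measurableTypeR R)) by exact: measurable_set1.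
  have /le_trans := measureU2 mu mN m0; apply.
  by rewrite [X in (X + _)%E]muN [X in (_ + X)%E]lebesgue_measure_set1 adde0.
- by move=> t _; rewrite lee_fin; apply: sumr_ge0 => a _; exact: sqr_ge0.
- by move=> t _; rewrite lee_fin; apply: sumr_ge0 => a _; exact: sqr_ge0.
- move=> t; rewrite /= in_itv/= andbT => t0 /not_orP[tN /eqP t00].
  congr EFin; apply: eq_bigr => a _; congr (_ ^+ 2).
  suff : forall a : 'I_n, 0 < t -> derive1 (fun s => h s a) t = g a t.
    by apply; rewrite lt_neqAle eq_sym t00.
  by apply: contrapT => Ht; apply: tN; exact: sN.
Qed.

Lemma measurable_density h g a : path_density h g -> measurable_fun setT (g a).
Proof. by move=> /(_ a)[]. Qed.

(** For [l1 + l2 = 1], the identity [l1 x^2 + l2 y^2 = (l1 x + l2 y)^2 + l1 l2 (x - y)^2] is applied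
    to the derivatives pointwise and integrated. *)
Lemma Hnorm2_convex h1 h2 l1 l2 : in_CM h1 -> in_CM h2 ->
  0 <= l1 -> 0 <= l2 -> l1 + l2 = 1 ->
  (l1%:E * Hnorm2 h1 + l2%:E * Hnorm2 h2 =
   Hnorm2 (path_lin l1 l2 h1 h2) + (l1 * l2)%:E * Hnorm2 (path_lin 1 (-1) h1 h2))%E.
Proof.
move=> /in_CM_path_density[g1 d1] /in_CM_path_density[g2 d2] l10 l20 l12.
rewrite (Hnorm2_density d1) (Hnorm2_density d2).
rewrite (Hnorm2_density (path_density_lin _ _ d1 d2)).
rewrite (Hnorm2_density (path_density_lin _ _ d1 d2)).
have mS (u : 'I_n -> R -> R) : (forall a, measurable_fun setT (u a)) ->
    measurable_fun (`[0%R, +oo[%classic : set R) (fun t => (\sum_(a < n) u a t ^+ 2)%:E).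
  move=> mu_; apply/measurable_EFinP; apply: (@measurable_funS _ _ _ _ setT) => //.
  by apply: measurable_sum => a; exact: measurable_funX.
have m1 a := measurable_density a d1; have m2 a := measurable_density a d2.
have S0 (u : 'I_n -> R -> R) t : (0 <= (\sum_(a < n) u a t ^+ 2)%:E)%E.
  by rewrite lee_fin; apply: sumr_ge0 => a _; exact: sqr_ge0.
have ml (c1 c2 : R) a : measurable_fun setT (fun t => c1 * g1 a t + c2 * g2 a t).
  by apply: measurable_funD; apply: measurable_funM.
have Z (c : R) (u : 'I_n -> R -> R) : 0 <= c -> (forall a, measurable_fun setT (u a)) ->
    (c%:E * \int[mu]_(t in `[0%R, +oo[%classic) (\sum_(a < n) u a t ^+ 2)%:E =
    \int[mu]_(t in `[0%R, +oo[%classic) (c%:E * (\sum_(a < n) u a t ^+ 2)%:E))%E.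
  by move=> c0 mu_; rewrite ge0_integralZl//; exact: mS.
have mZ (c : R) (u : 'I_n -> R -> R) : (forall a, measurable_fun setT (u a)) ->
    measurable_fun (`[0%R, +oo[%classic : set R)
      (fun t => c%:E * (\sum_(a < n) u a t ^+ 2)%:E)%E.
  by move=> mu_; apply: measurable_funeM; exact: mS.
have Z0 (c : R) (u : 'I_n -> R -> R) t : 0 <= c ->
    (0 <= c%:E * (\sum_(a < n) u a t ^+ 2)%:E)%E.
  by move=> c0; rewrite mule_ge0// lee_fin.
rewrite (Z l1 g1)// (Z l2 g2)// (Z (l1 * l2)) ?mulr_ge0//.
rewrite -ge0_integralD//; last 4 first.
- by move=> t _; exact: Z0.
- exact: mZ.
- by move=> t _; exact: Z0.
- exact: mZ.
rewrite -ge0_integralD//;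
  try by [apply: mS => a; exact: ml | apply: mZ => a; exact: ml]; last 2 first.
- by move=> t _; exact: (S0 (fun a t => l1 * g1 a t + l2 * g2 a t)).
- move=> t _; apply: (Z0 _ (fun a t => 1 * g1 a t + -1 * g2 a t)).
  exact: mulr_ge0.
apply: eq_integral => t _; rewrite -!EFinM -!EFinD; congr EFin.
rewrite !mulr_sumr -!big_split /=; apply: eq_bigr => a _.
have -> : l2 = 1 - l1 by rewrite -l12; ring.
ring.
Qed.

(** Cauchy-Schwarz through a tangent line: with the mean slope [c], [g^2 >= 2 c g - c^2], and the
    right side integrates to [D^2 / (y - x)]. *)
Lemma energy_step h g a x y : path_density h g -> 0 <= x -> x < y ->
  (((h y a - h x a) ^+ 2 / (y - x))%:E <=
   \int[mu]_(t in `]x, y]) ((g a t) ^+ 2)%:E)%E.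
Proof.
move=> dh x0 xy; have [mg ify _] := dh a.
have [|ig gE] := ify x y; first by rewrite x0 ltW.
have mI := measurable_itvR `]x, y].
set D := h y a - h x a; pose c := D / (y - x).
have yx0 : 0 < y - x by rewrite subr_gt0.
have mg2 : measurable_fun (`]x, y]%classic : set R) (fun t => (g a t ^+ 2)%:E).
  by apply/measurable_EFinP; apply: measurable_funX; exact: measurable_funS mg.
(* An infinite integral makes the bound trivial; a finite one makes [g^2] integrable. *)
have [->|fin] := eqVneq (\int[mu]_(t in `]x, y]) ((g a t) ^+ 2)%:E)%E +oo%E.
  by rewrite leey.
have ig2 : mu.-integrable `]x, y] (fun t => (g a t ^+ 2)%:E).
  apply/integrableP; split; first exact: mg2.
  under eq_integral do rewrite gee0_abs ?lee_fin ?sqr_ge0//.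
  by rewrite ltey.
have igc := integrableZl mI (2 * c) ig.
have icc : mu.-integrable `]x, y] (EFin \o cst (c ^+ 2)).
  apply/integrableP; split; first by apply/measurable_EFinP; exact: measurable_cst.
  rewrite (_ : (fun _ => _) = cst (`|c ^+ 2|%:E))// integral_cst//.
  by rewrite [X in (_ * X)%E]lebesgue_measure_itv/= lte_fin xy -EFinB -EFinM ltry.
have iB := integrableB mI igc icc.
have -> : (D ^+ 2 / (y - x))%:E =
    (\int[mu]_(t in `]x, y]) ((2 * c) * g a t - c ^+ 2)%:E)%E.
  transitivity (\int[mu]_(t in `]x, y]) ((2 * c) * g a t - c ^+ 2))%:E; last first.
    by rewrite /Rintegral fineK//; exact: integrable_fin_num iB.
  congr EFin; rewrite RintegralB// RintegralZl// -gE Rintegral_cst//.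
  rewrite [X in fine X]lebesgue_measure_itv/= lte_fin xy /= -/D /c.
  have yx : y - x != 0 by rewrite gt_eqF.
  by field.
apply: le_integral => //.
move=> t _; rewrite lee_fin -subr_ge0.
have -> : g a t ^+ 2 - (2 * c * g a t - c ^+ 2) = (g a t - c) ^+ 2 by ring.
exact: sqr_ge0.
Qed.

(** The bounds of [energy_step] add up over the disjoint steps of the partition, by induction on the
    number of steps. *)
Lemma energy_le h g (s : nat -> R) k : path_density h g -> s 0%N = 0 ->
  (forall j, (j < k)%N -> s j < s j.+1) ->
  ((\sum_(j < k) (\sum_(a < n) (h (s j.+1) a - h (s j) a) ^+ 2) / (s j.+1 - s j))%:E
    <= Hnorm2 h)%E.
Proof.
move=> dh s0 sS.
have mS (A : set R) : measurable_fun A (fun t => (\sum_(a < n) (g a t) ^+ 2)%:E).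
  apply/measurable_EFinP; apply: (@measurable_funS _ _ _ _ setT) => //.
  by apply: measurable_sum => a; apply: measurable_funX; exact: measurable_density dh.
have S0 t : (0 <= (\sum_(a < n) (g a t) ^+ 2)%:E)%E.
  by rewrite lee_fin; apply: sumr_ge0 => a _; exact: sqr_ge0.
have s_ge0 j : (j <= k)%N -> 0 <= s j.
  by elim: j => [|j ih] jk; rewrite ?s0// (le_trans (ih (ltnW jk)))// ltW ?sS.
suff main j : (j <= k)%N -> ((\sum_(i < j) (\sum_(a < n) (h (s i.+1) a - h (s i) a) ^+ 2)
    / (s i.+1 - s i))%:E <=
    \int[mu]_(t in `]0%R, s j]) (\sum_(a < n) (g a t) ^+ 2)%:E)%E.
  apply: le_trans (main k (leqnn k)) _; rewrite (Hnorm2_density dh).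
  apply: ge0_subset_integral => //; first exact: mS.
  by move=> t /=; rewrite !in_itv/= andbT => /andP[/ltW].
elim: j => [|j ih] jk; first by rewrite big_ord0 integral_ge0.
rewrite big_ord_recr /= EFinD.
rewrite (@itv_bndbnd_setU _ _ _ (BRight (s j)))//; last 2 first.
- by rewrite bnd_simp s_ge0// ltnW.
- by rewrite bnd_simp ltW// sS.
rewrite ge0_integral_setU//=; last 2 first.
- exact: mS.
- apply/disj_setPS => t [] /=; rewrite !in_itv/= => /andP[_ ts] /andP[st _].
  by have := lt_le_trans st ts; rewrite ltxx.
apply: leeD; first exact: ih (ltnW jk).
rewrite mulr_suml -sumEFin.
under [leRHS]eq_integral do rewrite -sumEFin.
rewrite ge0_integral_sum//; last 2 first.
- move=> a; apply/measurable_EFinP; apply: measurable_funX.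
  by apply: measurable_funS (measurable_density a dh).
- by move=> a t _; rewrite lee_fin sqr_ge0.
apply: lee_sum => a _; apply: energy_step => //; last exact: sS.
by rewrite s_ge0// ltnW.
Qed.
End PathDensity.

(** * Gaussian densities of cylinder rectangles *)

Section IteratedIntegral.
Context {R : realType}.
Notation mu := (@lebesgue_measure R).

(** Written with the same match as in [iterint], so that unfolding one integral gives
    [f (scons x v)] by conversion. *)
Definition scons (x : R) (v : nat -> R) : nat -> R :=
  fun i => if i is i'.+1 then v i' else x.

(* Measurability in finitely or countably many real variables, phrased without
   a sigma-algebra on [nat -> R]: measurable after substitution of measurable
   functions for the variables. *)
Definition mvfun (f : (nat -> R) -> \bar R) : Prop :=
  forall d (T : measurableType d) (u : nat -> T -> R),
    (forall i, measurable_fun setT (u i)) ->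
    measurable_fun setT (fun z => f (fun i => u i z)).

(** The image of Lebesgue measure under a translation agrees with it on half-open intervals, hence
    everywhere by uniqueness. *)
Lemma integral_shift (G : R -> \bar R) (c : R) : measurable_fun setT G ->
  (forall x, 0 <= G x)%E ->
  (\int[mu]_(x in [set: R]) G (x + c)%R = \int[mu]_(x in [set: R]) G x)%E.
Proof.
move=> mG G0; pose sh (x : R) : R := x + c.
have mc : measurable_fun setT (sh : measurableTypeR R -> measurableTypeR R).
  have : measurable_fun [set: R] sh by apply: measurable_funD.
  exact.
rewrite -[LHS](@ge0_integral_pushforward _ _ _ _ _ _ mc mu setT G)//.
apply: eq_measure_integral => A mA _.
apply/esym/lebesgue_measure_unique => //= _ [[a b]] _ <-.
transitivity (mu `]a - c, b - c]%classic); last first.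
  rewrite /= /pushforward; congr (mu _); apply/seteqP; split => x /=;
  by rewrite !in_itv/= /sh ltrBlDr lerBrDr.
rewrite !lebesgue_measure_itv/= !lte_fin ltrD2r; case: ifP => // _.
by rewrite -!EFinB; congr EFin; ring.
Qed.

Lemma iterint_ge0 m (f : (nat -> R) -> \bar R) :
  (forall v, 0 <= f v)%E -> (0 <= iterint m f)%E.
Proof.
elim: m f => [|m ih] f f0 /=; first exact: f0.
by apply: integral_ge0 => x _; apply: ih => v; exact: f0.
Qed.

(** The parameter ranges over an arbitrary measurable space so that the induction can absorb the
    outermost variable into it as a product; Tonelli then gives measurability of the partial
    integral. *)
Lemma measurable_iterint m d (T : measurableType d) (f : T -> (nat -> R) -> \bar R) :
  (forall x v, 0 <= f x v)%E ->
  (forall d' (T' : measurableType d') (k : T' -> T) (u : nat -> T' -> R),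
    measurable_fun setT k -> (forall i, measurable_fun setT (u i)) ->
    measurable_fun setT (fun z => f (k z) (fun i => u i z))) ->
  measurable_fun setT (fun x => iterint m (f x)).
Proof.
elim: m d T f => [|m ih] d T f f0 mf /=.
  by apply: (mf _ _ id (fun _ _ => 0)) => // i; exact: measurable_cst.
pose f' (p : T * measurableTypeR R) v := f p.1 (scons p.2 v).
have mf' : measurable_fun setT (fun p => iterint m (f' p)).
  apply: ih => [p v|d' T' k u mk m_u]; first exact: f0.
  rewrite /f'.
  rewrite (_ : (fun z => _) = fun z => f ((fst \o k) z)
    (fun i => (if i is i'.+1 then u i' else snd \o k) z)); last first.
    by apply/funext => z /=; congr (f _ _); apply/funext => -[|i].
  apply: mf => [|[|i]]; last exact: m_u.
    by apply: measurableT_comp => //; exact: measurable_fst.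
  by apply: (measurableT_comp _ mk); exact: measurable_snd.
have f'0 p : (0 <= iterint m (f' p))%E by apply: iterint_ge0 => v; exact: f0.
exact: (measurable_fun_fubini_tonelli_F (m2 := mu) _ mf' f'0).
Qed.

Lemma mvfun_scons f x : mvfun f -> mvfun (fun v => f (scons x v)).
Proof.
move=> mf d T u m_u.
rewrite (_ : (fun z => _) = fun z => f (fun i => (if i is i'.+1 then u i' else cst x) z)).
  by apply: mf => -[|i] //; exact: measurable_cst.
by apply/funext => z; congr f; apply/funext => -[|i].
Qed.

Lemma measurable_iterint_scons m f : mvfun f -> (forall v, 0 <= f v)%E ->
  measurable_fun setT (fun x => iterint m (fun v => f (scons x v))).
Proof.
move=> mf f0; apply: (@measurable_iterint m _ R (fun x v => f (scons x v))).
  by move=> x v; exact: f0.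
move=> d T k u mk m_u.
rewrite (_ : (fun z => _) = fun z => f (fun i => (if i is i'.+1 then u i' else k) z)).
  by apply: mf => -[|i].
by apply/funext => z; congr f; apply/funext => -[|i].
Qed.

Lemma le_iterint_lin m f g1 g2 (c1 c2 : R) : 0 <= c1 -> 0 <= c2 ->
  mvfun f -> mvfun g1 -> mvfun g2 ->
  (forall v, 0 <= f v)%E -> (forall v, 0 <= g1 v)%E -> (forall v, 0 <= g2 v)%E ->
  (forall v, f v <= c1%:E * g1 v + c2%:E * g2 v)%E ->
  (iterint m f <= c1%:E * iterint m g1 + c2%:E * iterint m g2)%E.
Proof.
move=> c10 c20; elim: m f g1 g2 => [|m ih] f g1 g2 mf mg1 mg2 f0 g10 g20 fg /=.
  exact: fg.
have m1 := measurable_iterint_scons m mg1 g10.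
have m2 := measurable_iterint_scons m mg2 g20.
have p1 x : (0 <= iterint m (fun v => g1 (scons x v)))%E by apply: iterint_ge0.
have p2 x : (0 <= iterint m (fun v => g2 (scons x v)))%E by apply: iterint_ge0.
rewrite -[X in (_ <= X + _)%E]ge0_integralZl;
  [|exact: measurableT|exact: m1|by move=> x _; exact: p1|by []].
rewrite -[X in (_ <= _ + X)%E]ge0_integralZl;
  [|exact: measurableT|exact: m2|by move=> x _; exact: p2|by []].
rewrite -ge0_integralD; last 5 first.
- exact: measurableT.
- by move=> x _; apply: mule_ge0 => //; exact: p1.
- exact: measurable_funeM.
- by move=> x _; apply: mule_ge0 => //; exact: p2.
- exact: measurable_funeM.
apply: ge0_le_integral => //.
- by move=> x _; exact: iterint_ge0.
- exact: (measurable_iterint_scons m mf f0).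
- by apply: emeasurable_funD; exact: measurable_funeM.
by move=> x _; apply: ih => //; exact: mvfun_scons.
Qed.

(** The condition on [s] from index [m] on matches [iterint], which sets to 0 the variables over
    which it does not integrate. *)
Lemma iterint_shift m f (s : nat -> R) : mvfun f -> (forall v, 0 <= f v)%E ->
  (forall i, (m <= i)%N -> s i = 0) ->
  iterint m (fun v => f (fun i => v i + s i)) = iterint m f.
Proof.
elim: m f s => [|m ih] f s mf f0 s0 /=.
  by congr f; apply/funext => i; rewrite s0// addr0.
pose G x := iterint m (fun v => f (scons x v)).
have G0 x : (0 <= G x)%E by apply: iterint_ge0.
rewrite -[RHS](@integral_shift G (s 0%N) (measurable_iterint_scons m mf f0) G0).
apply: eq_integral => x _; rewrite /G.
rewrite -(ih _ (fun i => s i.+1) (mvfun_scons (x + s 0%N) mf)) => [|v|i mi].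
- by congr iterint; apply/funext => v; congr f; apply/funext => -[|i].
- exact: f0.
- exact: s0.
Qed.

End IteratedIntegral.

(** * Wiener measure of shifted rectangles *)

Section RectangleDensity.
Context {R : realType} {n : nat}.
Variables (k : nat) (t : nat -> R) (A : nat -> 'I_n -> set R).
Hypothesis t0 : 0 < t 0%N.
Hypothesis tS : forall j, (j.+1 < k)%N -> t j < t j.+1.
Hypothesis mA : forall j a, measurable (A j a).

Definition coords (v : nat -> R) (j : nat) : 'I_n -> R := fun a => v (j * n + a)%N.

Definition shift_seq (y : nat -> 'I_n -> R) (j : nat) : 'I_n -> R :=
  if j is j'.+1 then y j' else (fun _ => 0).

(** For [b j = h (t j)] this is the joint density of [gamma + h] at the times [t j], cut off to the
    rectangle. [scons 0 t] and [shift_seq] supply the preceding time and position, both 0 at the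
    start. *)
Definition rect_density (b : nat -> 'I_n -> R) (v : nat -> R) : \bar R :=
  (\prod_(j < k) (heat_kernel (t j - scons 0 t j)
      (fun a => shift_seq (coords v) j a - shift_seq b j a)
      (fun a => coords v j a - b j a) *
    \prod_(a < n) (\1_(A j a) (coords v j a) : R)))%:E.

Definition shifted_rect (h : cpath R n) : set (Pathspace R n) :=
  [set g | forall j, (j < k)%N -> forall a : 'I_n, A j a (path_add g h (t j) a)].

Let dt_gt0 j : (j < k)%N -> 0 < t j - scons 0 t j.
Proof. by case: j => [|j] jk /=; rewrite ?subr0// subr_gt0 tS. Qed.

Lemma rect_density_ge0 b v : (0 <= rect_density b v)%E.
Proof.
rewrite lee_fin; apply: prodr_ge0 => j _; apply: mulr_ge0.
  by rewrite /heat_kernel mulr_ge0 ?powR_ge0 ?expR_ge0.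
by apply: prodr_ge0 => a _; rewrite indicE.
Qed.

Lemma mvfun_rect_density b : mvfun (rect_density b).
Proof.
move=> d T u mu_; apply/measurable_EFinP; apply: measurable_prod => j _.
apply: measurable_funM; last first.
  apply: measurable_prod => a _.
  by apply: (measurableT_comp (measurable_indic (mA j a))); exact: mu_.
apply: measurable_funM => //; apply: measurableT_comp => //.
apply: measurable_funM => //; apply: measurable_funN.
apply: measurable_sum => a; apply: measurable_funX.
apply: measurable_funB; apply: measurable_funB => //; last exact: mu_.
by case: {+}j => -[|j'] jk //=; exact: mu_.
Qed.

(** [gamma + h] lies in the rectangle [A] when [gamma] lies in its translate [A']; translating the
    integration variables by [h (t j)] then moves the shift from the indicators to the kernels. *)
Lemma wiener_rect_shift (P : probability (Pathspace R n) R) (h : cpath R n) :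
  is_wiener_measure P ->
  P (shifted_rect h) = iterint (n * k) (rect_density (fun j a => h (t j) a)).
Proof.
move=> wP; pose A' j a := [set x | A j a (1 * x + 1 * h (t j) a)].
have mA' j a : measurable (A' j a).
  rewrite -[A' j a]setTI.
  have mf : measurable_fun setT (fun x : R => 1 * x + 1 * h (t j) a).
    by apply: measurable_funD => //; apply: measurable_funM.
  exact: mf.
have := wP k t A' t0 tS mA'; rewrite [X in P X = _](_ : _ = shifted_rect h) // => ->.
(* Quotient and remainder recover [j] and [a] from the variable number [j * n + a]; beyond [n * k]
   the shift is 0, as [iterint_shift] asks. *)
pose s i : R := if (i < n * k)%N then
  (if insub (i %% n)%N is Some a then h (t (i %/ n)%N) a else 0) else 0.
have sE j (a : 'I_n) : (j < k)%N -> s (j * n + a)%N = h (t j) a.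
  move=> jk; have n0 : (0 < n)%N by case: {+}a => m; apply: leq_ltn_trans.
  have lt : (j * n + a < n * k)%N.
    rewrite mulnC; apply: (@leq_trans (n * j + n)); first by rewrite ltn_add2l.
    by rewrite -mulnSr leq_pmul2l.
  rewrite /s lt modnMDl modn_small// divnMDl// divn_small// addn0.
  by rewrite insubT//= => ?; congr (h _ _); exact: val_inj.
rewrite -(@iterint_shift _ _ _ s (mvfun_rect_density _) (rect_density_ge0 _)); last first.
  by move=> i ki; rewrite /s ltnNge ki.
congr iterint; apply/funext => v; congr EFin; apply: eq_bigr => -[j jk] _ /=.
have cE i a : (i < k)%N -> coords (fun i => v i + s i) i a - h (t i) a = v (i * n + a)%N.
  by move=> ik; rewrite /coords sE// addrK.
congr (_ * _).
  apply: (congr2 (heat_kernel _)); last by apply/funext => a; rewrite cE.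
  case: j jk => [|j] jk; apply/funext => a /=; first by rewrite subrr.
  by rewrite cE// ltnW.
apply: eq_bigr => a _; rewrite !indicE; congr (_%:R); congr nat_of_bool.
have -> : coords (fun i => v i + s i) j a = 1 * v (j * n + a)%N + 1 * h (t j) a.
  by rewrite !mul1r /coords sE.
by apply/idP/idP; rewrite !inE.
Qed.

(** The three densities share the factor [K] and differ only in the exponent [ex], which is
    quadratic in the shift, so that interpolating the shifts costs at most [C]. Convexity of the
    exponential, tilted by [th], does the rest. *)
Lemma le_rect_density (b1 b2 : nat -> 'I_n -> R) (l1 l2 th C : R) v :
  0 <= l1 -> 0 <= l2 -> l1 + l2 = 1 ->
  l1 * l2 / 4 * (\sum_(j < k) (\sum_(a < n)
     ((b1 j a - b2 j a) - (shift_seq b1 j a - shift_seq b2 j a)) ^+ 2)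
       / (t j - scons 0 t j)) <= C ->
  (rect_density (fun j a => (l1 * b1 j a + l2 * b2 j a)%R) v <=
    (expR C * l1 * expR (l2 * th))%:E * rect_density b1 v +
    (expR C * l2 * expR (- l1 * th))%:E * rect_density b2 v)%E.
Proof.
move=> l10 l20 l12 leC.
pose z (b : nat -> 'I_n -> R) j a : R :=
  (shift_seq (coords v) j a - shift_seq b j a) - (coords v j a - b j a).
pose ex b : R := \sum_(j < k) - (\sum_(a < n) z b j a ^+ 2) / (4 * (t j - scons 0 t j)).
pose K : R := \prod_(j < k) ((4 * pi * (t j - scons 0 t j)) `^ (- (n%:R / 2)) *
  \prod_(a < n) (\1_(A j a) (coords v j a))).
have dE b : rect_density b v = (K * expR (ex b))%:E.
  rewrite /rect_density /K /ex expR_sum -big_split /=; congr EFin.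
  by apply: eq_bigr => j _; rewrite /heat_kernel mulrAC.
have K0 : 0 <= K.
  apply: prodr_ge0 => j _; rewrite mulr_ge0 ?powR_ge0//.
  by apply: prodr_ge0 => a _; rewrite indicE.
rewrite !dE -!EFinM -EFinD lee_fin.
set bl := fun j a => _.
(* [l1 |z1|^2 + l2 |z2|^2 = |l1 z1 + l2 z2|^2 + l1 l2 |z1 - z2|^2] *)
have exE : ex bl <= l1 * ex b1 + l2 * ex b2 + C.
  rewrite addrC -lerBlDr; apply: le_trans leC; rewrite /ex.
  rewrite !mulr_sumr -big_split -sumrB; apply: ler_sum => j _ /=.
  have dj := dt_gt0 (ltn_ord j); set D := _ - _ in dj *.
  rewrite le_eqVlt; apply/orP; left; apply/eqP.
  have zl : \sum_(a < n) z bl j a ^+ 2 = l1 * (\sum_(a < n) z b1 j a ^+ 2) +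
     l2 * (\sum_(a < n) z b2 j a ^+ 2) - l1 * l2 * (\sum_(a < n)
     ((b1 j a - b2 j a) - (shift_seq b1 j a - shift_seq b2 j a)) ^+ 2).
    rewrite !mulr_sumr -big_split -sumrB; apply: eq_bigr => a _ /=.
    rewrite /z /bl; have -> : l2 = 1 - l1 by rewrite -l12; ring.
    case: {+}j => -[|j'] jk /=; ring.
  rewrite zl; have D0 : D != 0 by rewrite gt_eqF.
  by field.
have cvx : expR (l1 * ex b1 + l2 * ex b2) <=
    l1 * (expR (l2 * th) * expR (ex b1)) + l2 * (expR (- l1 * th) * expR (ex b2)).
  rewrite -!expRD; set x1 := l2 * th + _; set x2 := - l1 * th + _.
  (* The tilts cancel in the weighted mean [m]; the tangent of the exponential at [m] then gives the
     two-point convexity inequality. *)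
  have -> : l1 * ex b1 + l2 * ex b2 = l1 * x1 + l2 * x2 by rewrite /x1 /x2; ring.
  set m := l1 * x1 + _.
  have e1 : expR m * (1 + (x1 - m)) <= expR x1.
    have -> : expR x1 = expR m * expR (x1 - m) by rewrite -expRD addrC subrK.
    by rewrite ler_wpM2l ?expR_ge0// expR_ge1Dx.
  have e2 : expR m * (1 + (x2 - m)) <= expR x2.
    have -> : expR x2 = expR m * expR (x2 - m) by rewrite -expRD addrC subrK.
    by rewrite ler_wpM2l ?expR_ge0// expR_ge1Dx.
  apply: le_trans (lerD (ler_wpM2l l10 e1) (ler_wpM2l l20 e2)).
  rewrite le_eqVlt; apply/orP; left; apply/eqP.
  have -> : l1 * (expR m * (1 + (x1 - m))) + l2 * (expR m * (1 + (x2 - m))) =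
     expR m * ((l1 + l2) * (1 - m) + (l1 * x1 + l2 * x2)) by ring.
  by rewrite l12 mul1r -/m subrK mulr1.
apply: (@le_trans _ _ (K * (expR C * expR (l1 * ex b1 + l2 * ex b2)))).
  by rewrite ler_wpM2l// -expRD ler_expR addrC.
apply: (@le_trans _ _ (K * (expR C * (l1 * (expR (l2 * th) * expR (ex b1)) +
  l2 * (expR (- l1 * th) * expR (ex b2)))))).
  by rewrite !ler_wpM2l// expR_ge0.
rewrite le_eqVlt; apply/orP; left; apply/eqP; ring.
Qed.

End RectangleDensity.

(** By [energy_le] the constant [C] can be chosen independently of [k], [t] and [A]; this uniformity
    is what lets the inequality extend from rectangles to all measurable sets. *)
Lemma wiener_rect_le (R : realType) (n : nat) (P : probability (Pathspace R n) R)
  (k : nat) (t : nat -> R) (A : nat -> 'I_n -> set R) (h1 h2 : cpath R n)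
  (g : 'I_n -> R -> R) (l1 l2 th C : R) :
  is_wiener_measure P ->
  0 < t 0%N -> (forall j, (j.+1 < k)%N -> t j < t j.+1) ->
  (forall j a, measurable (A j a)) ->
  path_density (path_lin 1 (-1) h1 h2) g ->
  0 <= l1 -> 0 <= l2 -> l1 + l2 = 1 ->
  ((l1 * l2 / 4)%:E * Hnorm2 (path_lin 1 (-1) h1 h2) <= C%:E)%E ->
  (P (shifted_rect k t A (path_lin l1 l2 h1 h2)) <=
    (expR C * l1 * expR (l2 * th))%:E * P (shifted_rect k t A h1) +
    (expR C * l2 * expR (- l1 * th))%:E * P (shifted_rect k t A h2))%E.
Proof.
move=> wP t0 tS mA dh l10 l20 l12 leC.
rewrite !wiener_rect_shift//.
apply: le_iterint_lin; try exact: mvfun_rect_density; try exact: rect_density_ge0.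
- by rewrite !mulr_ge0 ?expR_ge0.
- by rewrite !mulr_ge0 ?expR_ge0.
move=> v; apply: le_rect_density => //.
have tS' j : (j < k)%N -> scons 0 t j < scons 0 t j.+1 by case: j => [|j] jk //=; exact: tS.
have := @energy_le _ _ _ _ (scons 0 t) k dh erefl tS' => E.
rewrite -lee_fin; apply: le_trans leC; rewrite EFinM.
apply: lee_wpmul2l; first by rewrite lee_fin divr_ge0// mulr_ge0.
apply: le_trans E; rewrite lee_fin le_eqVlt; apply/orP; left; apply/eqP.
apply: eq_bigr => -[j jk] _ /=; congr (_ / _); apply: eq_bigr => a _; congr (_ ^+ 2).
case: j jk => [|j] jk /=; last by ring.
(* The first increment starts at time 0, where both paths vanish. *)
have h0 (h : cpath R n) : h 0 a = 0 by case: h => h [/= ->].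
by rewrite !h0; ring.
Qed.

(** * Translates of the Wiener measure *)

Section ShiftedWienerMeasures.
Context {R : realType} {n : nat}.
Variable P : probability (Pathspace R n) R.
Implicit Types (h : cpath R n) (S : set (Pathspace R n)).

Lemma measurable_path_add h :
  measurable_fun setT ((fun g => path_add g h) : Pathspace R n -> Pathspace R n).
Proof.
apply: (@measurability _ _ (Pathspace R n) (Pathspace R n) _ _ (@cylinders R n)) => //.
move=> _ [_ [t [a [A [t0 mA ->]]]] <-]; rewrite setTI.
apply: sub_sigma_algebra; exists t, a, [set x | A (1 * x + 1 * h t a)]; split => //.
have mf : measurable_fun setT (fun x : R => 1 * x + 1 * h t a).
  by apply: measurable_funD => //; apply: measurable_funM.
by rewrite -[X in measurable X]setTI; exact: mf.
Qed.

Definition path_shift h S : set (Pathspace R n) := [set g | S (path_add g h)].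

Lemma measurable_path_shift h S : measurable S -> measurable (path_shift h S).
Proof.
by move=> mS; rewrite -[path_shift h S]setTI; exact: measurable_path_add.
Qed.

Variables (h0 h1 h2 : cpath R n) (c1 c2 : R).
Hypotheses (c10 : 0 <= c1) (c20 : 0 <= c2).

(** Measurability is built in so that continuity of [P] along monotone sequences makes these sets a
    monotone class. *)
Definition shift_dominated S := measurable S /\
  (P (path_shift h0 S) <= c1%:E * P (path_shift h1 S) + c2%:E * P (path_shift h2 S))%E.

Lemma shift_dominated0 : shift_dominated set0.
Proof.
split; first exact: measurable0.
have -> : path_shift h0 set0 = set0 by [].
by rewrite measure0 adde_ge0// mule_ge0.
Qed.

Lemma shift_dominatedU S1 S2 : S1 `&` S2 = set0 ->
  shift_dominated S1 -> shift_dominated S2 -> shift_dominated (S1 `|` S2).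
Proof.
move=> S12 [mS1 le1] [mS2 le2]; split; first exact: measurableU.
have PU h : P (path_shift h (S1 `|` S2)) = (P (path_shift h S1) + P (path_shift h S2))%E.
  rewrite -measureU; [by []|exact: measurable_path_shift|exact: measurable_path_shift|].
  by rewrite -subset0 => g [g1 g2]; have : (S1 `&` S2) (path_add g h) by []; rewrite S12.
rewrite !PU !ge0_muleDr//; apply: le_trans (leeD le1 le2) _.
by rewrite addeACA.
Qed.

Let lim_dominated F S : (forall i, shift_dominated (F i)) ->
  (forall h, P (path_shift h (F i)) @[i --> \oo] --> P (path_shift h S)) ->
  (P (path_shift h0 S) <= c1%:E * P (path_shift h1 S) + c2%:E * P (path_shift h2 S))%E.
Proof.
move=> dF cF.
have Pfin h S' : measurable S' -> P (path_shift h S') \is a fin_num.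
  by move=> mS'; apply: fin_num_measure; exact: measurable_path_shift.
have cR : (c1%:E * P (path_shift h1 (F i)) + c2%:E * P (path_shift h2 (F i)))%E @[i --> \oo]
    --> (c1%:E * P (path_shift h1 S) + c2%:E * P (path_shift h2 S))%E.
  apply: cvgeD; last 2 first.
  - by apply: cvgeZl => //; exact: cF.
  - by apply: cvgeZl => //; exact: cF.
  by apply: ge0_adde_def; rewrite inE mule_ge0.
have E0 := cvg_lim (@ereal_hausdorff R) (cF h0).
have E1 := cvg_lim (@ereal_hausdorff R) cR.
rewrite -[leLHS]E0 -[leRHS]E1; apply: lee_lim.
- by apply/cvg_ex; eexists; exact: (cF h0).
- by apply/cvg_ex; eexists; exact: cR.
- by apply: nearW => i; exact: (dF i).2.
Qed.

Lemma monotone_shift_dominated : monotone shift_dominated.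
Proof.
split.
- move=> F ndF dF.
  have mF : measurable (\bigcup_i F i) by apply: bigcup_measurable => i _; exact: (dF i).1.
  split => //; apply: (lim_dominated dF) => h.
  have -> : path_shift h (\bigcup_i F i) = \bigcup_i (path_shift h (F i)) by [].
  apply: nondecreasing_cvg_mu.
  + by move=> i; apply: measurable_path_shift; exact: (dF i).1.
  + by apply: bigcup_measurable => i _; apply: measurable_path_shift; exact: (dF i).1.
  + move=> i j ij; apply/subsetPset => g.
    by have /subsetPset := ndF i j ij; apply.
- move=> F ndF dF.
  have mF : measurable (\bigcap_i F i).
    by apply: bigcap_measurable => [|i _]; [exists 0%N|exact: (dF i).1].
  split => //; apply: (lim_dominated dF) => h.
  have -> : path_shift h (\bigcap_i F i) = \bigcap_i (path_shift h (F i)) by [].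
  apply: nonincreasing_cvg_mu.
  + by rewrite ltey_eq fin_num_measure//; apply: measurable_path_shift; exact: (dF 0%N).1.
  + by move=> i; apply: measurable_path_shift; exact: (dF i).1.
  + by apply: bigcap_measurable => [|i _]; [exists 0%N|
        apply: measurable_path_shift; exact: (dF i).1].
  + move=> i j ij; apply/subsetPset => g.
    by have /subsetPset := ndF i j ij; apply.
Qed.

(* A constraint [(t, a, B)] stands for [gamma_t^a \in B]. *)
Let constraint : Type := R * 'I_n * set R.
Implicit Types (c : constraint) (L : seq constraint) (phi : seq bool -> bool).

Definition sat (g : cpath R n) (c : R * 'I_n * set R) : bool :=
  `[< c.2 (g c.1.1 c.1.2) >].

Definition constraint_ok (c : R * 'I_n * set R) : bool :=
  `[< 0 <= c.1.1 /\ measurable c.2 >].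

Definition cyl_and (L : seq (R * 'I_n * set R)) : set (Pathspace R n) :=
  [set g | all (sat g) L].

(** Encoding a set by a boolean function of membership bits allows case analysis on one bit at a
    time. *)
Definition cyl_bool (phi : seq bool -> bool) (L : seq (R * 'I_n * set R)) :
  set (Pathspace R n) := [set g | phi (map (sat g) L)].

Definition cyl_algebra : set (set (Pathspace R n)) :=
  [set S | exists phi L, all constraint_ok L /\ S = cyl_bool phi L].

Lemma measurable_sat c : constraint_ok c -> measurable [set g : Pathspace R n | sat g c].
Proof.
move=> /asboolP[t0 mB]; apply: sub_sigma_algebra.
exists c.1.1, c.1.2, c.2; split => //.
by apply/seteqP; split => g /asboolP.
Qed.

Lemma measurable_cyl_and L : all constraint_ok L -> measurable (cyl_and L).
Proof.
elim: L => [_|c L ih /= /andP[okc /ih mL]].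
  by rewrite (_ : cyl_and _ = setT)//; exact/seteqP.
rewrite (_ : cyl_and _ = [set g : Pathspace R n | sat g c] `&` cyl_and L).
  by apply: measurableI => //; exact: measurable_sat.
by apply/seteqP; split => g /= /andP.
Qed.

Lemma measurable_all_mem (p : pred (R * 'I_n * set R)) L : all constraint_ok L ->
  measurable [set x : R | all (fun c : constraint => p c ==> `[< c.2 x >]) L].
Proof.
elim: L => [_|c L ih /= /andP[/asboolP[_ mB] /ih mL]].
  by rewrite (_ : mkset _ = setT)//; exact/seteqP.
rewrite (_ : mkset _ = [set x | p c -> c.2 x] `&`
    [set x : R | all (fun c : constraint => p c ==> `[< c.2 x >]) L]).
  apply: measurableI => //; case: (p c).
    by rewrite (_ : mkset _ = c.2)//; apply/seteqP; split => x /=; [apply|].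
  by rewrite (_ : mkset _ = setT)//; exact/seteqP.
apply/seteqP; split => x /=.
  by move=> /andP[/implyP pc ->]; split => // /pc/asboolP.
by move=> [pc ->]; rewrite andbT; apply/implyP => /pc/asboolP.
Qed.

(** Any binary boolean operation on two such sets is obtained by concatenating their constraint
    lists; [take] and [drop] separate the bits again. *)
Lemma setring_cyl_algebra : setring cyl_algebra.
Proof.
have op (b : bool -> bool -> bool) S1 S2 : cyl_algebra S1 -> cyl_algebra S2 ->
    cyl_algebra [set g | b `[< S1 g >] `[< S2 g >]].
  move=> [phi1 [L1 [ok1 ->]]] [phi2 [L2 [ok2 ->]]].
  exists (fun s => b (phi1 (take (size L1) s)) (phi2 (drop (size L1) s))), (L1 ++ L2).
  rewrite all_cat ok1 ok2; split => //; apply/seteqP; split => g /=;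
  by rewrite /cyl_bool /= map_cat take_size_cat ?size_map// drop_size_cat ?size_map// !asboolb.
split.
- by exists (fun=> false), [::]; split => //; apply/seteqP; split.
- move=> S1 S2 a1 a2; have := op orb _ _ a1 a2; congr cyl_algebra.
  by apply/seteqP; split => g /=; [move=> /orP[/asboolP|/asboolP]; [left|right]
    |move=> [|] /asboolP ->; rewrite ?orbT].
- move=> S1 S2 a1 a2; have := op (fun x y => x && ~~ y) _ _ a1 a2; congr cyl_algebra.
  by apply/seteqP; split => g /= => [/andP[/asboolP ? /asboolPn ?]|[/asboolP -> /asboolPn ->]].
Qed.

Hypothesis rect_dominated : forall k (t : nat -> R) (A : nat -> 'I_n -> set R),
  0 < t 0%N -> (forall j, (j.+1 < k)%N -> t j < t j.+1) ->
  (forall j a, measurable (A j a)) ->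
  (P (shifted_rect k t A h0) <=
    c1%:E * P (shifted_rect k t A h1) + c2%:E * P (shifted_rect k t A h2))%E.

(** Constraints at the same positive time and coordinate are intersected, and the distinct times are
    sorted. Those at time 0 concern the fixed value 0, so together they reduce to the truth value
    [z]. *)
Lemma cyl_and_dominated L : all constraint_ok L -> shift_dominated (cyl_and L).
Proof.
move=> okL; split; first exact: measurable_cyl_and.
pose ts := sort <=%R (undup [seq c.1.1 | c <- L & 0 < c.1.1]).
(* The default 1 keeps [0 < t 0] true when no positive time occurs. *)
pose t j := nth 1 ts j.
pose z := all (fun c : constraint => (c.1.1 == 0) ==> `[< c.2 0 >]) L.
pose A j a := [set x | all (fun c : constraint =>
  ((c.1.1 == t j) && (c.1.2 == a)) ==> `[< c.2 x >]) L].
have tsE x : (x \in ts) = (x \in [seq c.1.1 | c <- L & 0 < c.1.1]).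
  by rewrite mem_sort mem_undup.
have ts_gt0 x : x \in ts -> 0 < x.
  by rewrite tsE => /mapP[c]; rewrite mem_filter => /andP[c0 _] ->.
have g0 (g : cpath R n) a : g 0 a = 0 by case: g => g [/= ->].
have cylE (g : cpath R n) : all (sat g) L <->
    z /\ forall j, (j < size ts)%N -> forall a, A j a (g (t j) a).
  split=> [/allP satL|[/allP zL AL]].
    split; first by apply/allP => c /satL; rewrite /sat; case: eqP => //= ->; rewrite g0.
    move=> j jk a; apply/allP => c /satL; rewrite /sat.
    by case: eqP => //= ->; case: eqP => //= ->.
  apply/allP => c cL; have /asboolP[c_ge0 _] := allP okL _ cL.
  have [c0|c0] := eqVneq c.1.1 0.
    by have := zL _ cL; rewrite c0 eqxx /= /sat c0 g0.
  have cts : c.1.1 \in ts.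
    rewrite tsE; apply/mapP; exists c => //.
    by rewrite mem_filter cL andbT lt_neqAle eq_sym c0.
  have jk : (index c.1.1 ts < size ts)%N by rewrite index_mem.
  have /allP/(_ _ cL) := AL _ jk c.1.2.
  by rewrite /t nth_index// !eqxx /=.
have [zT|zF] := boolP z; last first.
  rewrite (_ : cyl_and L = set0); first by have [] := shift_dominated0.
  by apply/seteqP; split => g //= /cylE[]; rewrite (negbTE zF).
rewrite (_ : cyl_and L = [set g : Pathspace R n | forall j, (j < size ts)%N ->
    forall a, A j a (g (t j) a)]); last first.
  by apply/seteqP; split => g /= => [/cylE[]|H] //; apply/cylE.
apply: rect_dominated.
- by rewrite /t; case E : ts => [|x s] //=; apply: ts_gt0; rewrite E mem_head.
- have sts : sorted <%R ts by rewrite sort_lt_sorted undup_uniq.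
  by move=> j jk; apply: (sorted_ltn_nth lt_trans 1 sts); rewrite ?inE ?(ltnW jk) ?ltnSn.
- by move=> j a; exact: measurable_all_mem.
Qed.

(** Induction on [L]: the first constraint or its complement moves to [Q], which splits the set into
    two disjoint pieces. With no bits left, [phi] is constant and the set is either [cyl_and Q] or
    empty. *)
Lemma cyl_bool_dominated phi L Q : all constraint_ok L -> all constraint_ok Q ->
  shift_dominated (cyl_and Q `&` cyl_bool phi L).
Proof.
elim: L phi Q => [|c L ih] phi Q /=.
  move=> _ okQ; case E : (phi [::]).
    rewrite (_ : _ `&` _ = cyl_and Q); first exact: cyl_and_dominated.
    by apply/seteqP; split => g /=; [case|split => //; rewrite /cyl_bool/= E].
  rewrite (_ : _ `&` _ = set0); first exact: shift_dominated0.
  by apply/seteqP; split => g //= [_]; rewrite /cyl_bool/= E.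
move=> /andP[okc okL] okQ.
pose c' : constraint := (c.1, ~` c.2).
have okc' : constraint_ok c'.
  by move: okc => /asboolP[? ?]; apply/asboolP; split => //; exact: measurableC.
have satc' g : sat g c' = ~~ sat g c by rewrite /sat /= asbool_neg.
rewrite (_ : _ `&` _ = (cyl_and (c :: Q) `&` cyl_bool (phi \o cons true) L) `|`
  (cyl_and (c' :: Q) `&` cyl_bool (phi \o cons false) L)); last first.
  apply/seteqP; split => g /=; rewrite /cyl_and /cyl_bool /= satc'.
    by move=> [gQ gphi]; case E : (sat g c) gphi => gphi; [left|right].
  by move=> [] [/andP[gc ->] gphi]; split => //; [rewrite gc|rewrite (negbTE gc)].
apply: shift_dominatedU; last 2 first.
- by apply: ih => //=; rewrite okc.
- by apply: ih => //=; rewrite okc'.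
rewrite -subset0 => g [[+ _] [+ _]]; rewrite /cyl_and /= satc'.
by move=> /andP[-> _].
Qed.

(** The monotone class theorem reaches the sigma-ring generated by [cyl_algebra], which contains the
    sigma-algebra generated by the cylinders. *)
Lemma all_shift_dominated S : measurable S -> shift_dominated S.
Proof.
have alg : cyl_algebra `<=` shift_dominated.
  move=> _ [phi [L [okL ->]]].
  have := cyl_bool_dominated phi okL (isT : all constraint_ok [::]).
  by rewrite (_ : cyl_and [::] = setT) ?setTI//; apply/seteqP; split.
have := monotone_setring_sub_g_sigma_ring monotone_shift_dominated setring_cyl_algebra alg.
have gen_sub : cyl_algebra `<=` <<sr cyl_algebra>> by exact: sub_gen_smallest.
move=> sub mS; apply: sub; move: S mS; apply: smallest_sub.
  (* The whole space belongs to the ring, so the sigma-ring is closed under complements. *)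
  have [sr0 srD srU] := smallest_sigma_ring cyl_algebra.
  split => // A mA; apply: srD => //; apply: gen_sub.
  exists (fun=> true), [::]; split=> //.
  by apply/seteqP; split=> g.
move=> _ [t [a [A [t0 mA ->]]]]; apply: gen_sub.
exists (head false), [:: (t, a, A)]; split.
  by rewrite /= andbT; apply/asboolP.
by apply/seteqP; split => g /= /asboolP.
Qed.

End ShiftedWienerMeasures.

(** * Integrals along shifted paths *)

Section ShiftedIntegral.
Context {R : realType} {n : nat}.
Variable P : probability (Pathspace R n) R.

(** A named map that can carry the measurable-function structure expected by [distribution]. *)
Definition path_translate (h : cpath R n) (g : Pathspace R n) : Pathspace R n :=
  path_add g h.

HB.instance Definition _ h := @isMeasurableFun.Build _ _ _ _ (path_translate h)
  (measurable_path_add h).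

(** Each integral is one of [F] against the law of a shifted path, so an inequality between measures
    suffices. *)
Lemma le_integral_shift_dominated (F : Pathspace R n -> \bar R)
  (h0 h1 h2 : cpath R n) (c1 c2 : R) : 0 <= c1 -> 0 <= c2 ->
  (forall S, measurable S -> shift_dominated P h0 h1 h2 c1 c2 S) ->
  measurable_fun setT F -> (forall g, 0 <= F g)%E ->
  (\int[P]_g F (path_add g h0) <=
    c1%:E * \int[P]_g F (path_add g h1) + c2%:E * \int[P]_g F (path_add g h2))%E.
Proof.
move=> c10 c20 dom mF F0.
have intE h : (\int[P]_g F (path_add g h) =
    \int[distribution P (path_translate h)]_g F g)%E.
  by rewrite ge0_integral_distribution.
rewrite !intE; pose k1 := NngNum c10; pose k2 := NngNum c20.
pose nu1 := mscale k1 (distribution P (path_translate h1)).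
pose nu2 := mscale k2 (distribution P (path_translate h2)).
have -> : (c1%:E * \int[distribution P (path_translate h1)]_g F g +
    c2%:E * \int[distribution P (path_translate h2)]_g F g)%E =
    (\int[measure_add nu1 nu2]_g F g)%E.
  rewrite ge0_integral_measure_add//.
  by rewrite /nu1 /nu2 !ge0_integral_mscale.
apply: ge0_le_measure_integral => // S mS.
rewrite [leRHS](@measure_addE _ _ _ nu1 nu2).
exact: (dom S mS).2.
Qed.

(** A zero integral would make the positive integrand vanish almost everywhere, so the whole space
    would be null. Positivity keeps [ln] in [PhiF] away from its default values. *)
Lemma shifted_integral_gt0 (F : Pathspace R n -> R) (h : cpath R n) :
  measurable_fun setT F -> (forall g, 0 < F g) ->
  (0 < \int[P]_g (F (path_add g h))%:E)%E.
Proof.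
move=> mF F0; rewrite lt_neqAle eq_sym; apply/andP; split; last first.
  by apply: integral_ge0 => g _; rewrite lee_fin ltW.
apply/eqP => I0.
have mFh : measurable_fun setT (fun g : Pathspace R n => (F (path_add g h))%:E).
  apply/measurable_EFinP.
  exact: (measurableT_comp mF (measurable_path_add h)).
have : (\int[P]_g `|(F (path_add g h))%:E| = 0)%E.
  rewrite -I0; apply: eq_integral => g _.
  by rewrite gee0_abs// lee_fin ltW.
move=> /(ae_eq_integral_abs P measurableT mFh)[N [mN PN sN]].
have NT : N = setT.
  rewrite -subTset => g _; apply: sN => /= /(_ Logic.I) [] /eqP.
  by rewrite gt_eqF.
have := probability_setT P; rewrite -NT [X in X = _]PN => /eqP.
by rewrite eq_sym onee_eq0.
Qed.

End ShiftedIntegral.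

(** The left side is finite and [l1 * l2 > 0], so neither nonnegative term on the right can be
    infinite. This makes the norms of the combination and of the difference real. *)
Lemma convex_comb_fin (R : realType) (l1 l2 a1 a2 : R) (x y : \bar R) :
  0 < l1 -> 0 < l2 -> (0 <= x)%E -> (0 <= y)%E ->
  (l1%:E * a1%:E + l2%:E * a2%:E = x + (l1 * l2)%:E * y)%E ->
  exists al ad, [/\ x = al%:E, y = ad%:E & l1 * a1 + l2 * a2 = al + l1 * l2 * ad].
Proof.
move=> l10 l20; case: x => [al| |] //; case: y => [ad| |] // _ _.
- by rewrite -!EFinM -!EFinD => -[E]; exists al, ad.
- by rewrite gt0_muley ?lte_fin ?mulr_gt0// addey// -!EFinM -EFinD.
- by rewrite gt0_muley ?lte_fin ?mulr_gt0// addye// -!EFinM -EFinD.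
Qed.

(** * Convexity of the functional *)

Unset Implicit Arguments.

Theorem mainTheorem1 (R : realType) (n : nat)
  (P : probability (Pathspace R n) R) (F : Pathspace R n -> R) :
  is_wiener_measure P ->
  measurable_fun [set: Pathspace R n] F ->
  (forall g, 0 < F g) ->
  P.-integrable [set: Pathspace R n] (fun g => (F g)%:E) ->
  forall (h1 h2 : cpath R n) (l1 l2 : R),
    in_CM h1 -> in_CM h2 ->
    0 < l1 < 1 -> 0 < l2 < 1 -> l1 + l2 = 1 ->
    (PhiF P F (path_lin l1 l2 h1 h2)
      <= l1%:E * PhiF P F h1 + l2%:E * PhiF P F h2)%E.
Proof.
move=> wP mF F0 _ h1 h2 l1 l2 cm1 cm2 /andP[l10 _] /andP[l20 _] l12.
have := Hnorm2_convex cm1 cm2 (ltW l10) (ltW l20) l12.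
set hl := path_lin l1 l2 h1 h2; set d := path_lin 1 (-1) h1 h2.
have Hn0 (h : cpath R n) : (0 <= Hnorm2 h)%E.
  by apply: integral_ge0 => t _; rewrite lee_fin; apply: sumr_ge0 => a _; exact: sqr_ge0.
have X0 h := shifted_integral_gt0 P h mF F0.
have X1 := X0 h1; have X2 := X0 h2; have Xl := X0 hl.
have [a1 Ha1] : exists r, Hnorm2 h1 = r%:E.
  by exists (fine (Hnorm2 h1)); rewrite fineK// ge0_fin_numE//; exact: cm1.2.
have [a2 Ha2] : exists r, Hnorm2 h2 = r%:E.
  by exists (fine (Hnorm2 h2)); rewrite fineK// ge0_fin_numE//; exact: cm2.2.
rewrite Ha1 Ha2 => Hconv.
have [al [ad [Hal Had {}Hconv]]] := convex_comb_fin l10 l20 (Hn0 hl) (Hn0 d) Hconv.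
rewrite /PhiF Ha1 Ha2 Hal -!EFinM.
(* If either integral on the right is infinite, so is the right side, since the other term is not
   [-oo]. *)
case E1 : (\int[P]_g _)%E X1 => [x1| |] //= x10; last first.
  rewrite gt0_muley ?lte_fin//.
  case E2 : (\int[P]_g _)%E X2 => [x2| |] //= _; first by rewrite addye ?leey// -EFinM.
  by rewrite gt0_muley ?lte_fin// addye ?leey.
case E2 : (\int[P]_g (F (path_add g h2))%:E)%E X2 => [x2| |] //= x20; last first.
  by rewrite gt0_muley ?lte_fin// -EFinM addey ?leey.
rewrite !lte_fin in x10 x20.
(* This [th] equalises the two terms: [e^(l2 th) x1 = e^(- l1 th) x2 = x1^l1 x2^l2], the geometric
   mean whose logarithm is [m] below. *)
pose C := l1 * l2 / 4 * ad; pose th := ln x2 - ln x1.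
have c10 : 0 <= expR C * l1 * expR (l2 * th) by rewrite !mulr_ge0 ?expR_ge0// ltW.
have c20 : 0 <= expR C * l2 * expR (- l1 * th) by rewrite !mulr_ge0 ?expR_ge0// ltW.
have [g1 d1] := in_CM_path_density cm1; have [g2 d2] := in_CM_path_density cm2.
have domS S : measurable S -> shift_dominated P hl h1 h2
    (expR C * l1 * expR (l2 * th)) (expR C * l2 * expR (- l1 * th)) S.
  apply: all_shift_dominated => // k t A t0 tS mA.
  apply: (wiener_rect_le th wP t0 tS mA (path_density_lin 1 (-1) d1 d2)) => //.
  - exact: ltW.
  - exact: ltW.
  - by rewrite -/d Had -EFinM lee_fin.
have leX := le_integral_shift_dominated (F := EFin \o F) c10 c20 domS _ _.
have {leX} : (\int[P]_g (F (path_add g hl))%:E <=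
    (expR C * l1 * expR (l2 * th))%:E * x1%:E + (expR C * l2 * expR (- l1 * th))%:E * x2%:E)%E.
  rewrite -E1 -E2; apply: leX; first exact/measurable_EFinP.
  by move=> g; rewrite lee_fin ltW.
(* The bound just obtained is real, which rules out an infinite integral for [hl]. *)
case: (\int[P]_g _)%E Xl => [y| |] //; rewrite lte_fin => y0.
rewrite -!EFinM -!EFinD !lee_fin => yle.
pose m := l1 * ln x1 + l2 * ln x2.
have {yle} lny : ln y <= C + m.
  rewrite -[leRHS]expRK ler_ln ?posrE ?expR_gt0//.
  apply: (le_trans yle); rewrite le_eqVlt; apply/orP; left; apply/eqP.
  have e1 : expR (l2 * th) * x1 = expR m.
    rewrite -[x1 in LHS](lnK (x := x1)) ?posrE// -expRD; congr expR.
    rewrite /th /m; have -> : l1 = 1 - l2 by rewrite -l12; ring.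
    ring.
  have e2 : expR (- l1 * th) * x2 = expR m.
    rewrite -[x2 in LHS](lnK (x := x2)) ?posrE// -expRD; congr expR.
    rewrite /th /m; have -> : l2 = 1 - l1 by rewrite -l12; ring.
    ring.
  transitivity (expR C * (l1 * (expR (l2 * th) * x1) + l2 * (expR (- l1 * th) * x2))).
    by ring.
  by rewrite e1 e2 -mulrDl l12 mul1r [RHS]expRD.
(* The gap is the slack in [lny] plus a quarter of the defect in [Hconv], which is zero. *)
rewrite -subr_ge0.
rewrite (_ : _ - _ = (C + m - ln y) + (l1 * a1 + l2 * a2 - (al + l1 * l2 * ad)) / 4).
  by rewrite Hconv subrr mul0r addr0 subr_ge0.
by rewrite /C /m; field.
Qed.
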